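(* There exists a reversible Turing machine which is (topologically) mixing of all finite orders in the moving head model.
   Context: Fix a dimension $d\ge1$. For a finite nonempty set $Q$ and a symbol $\#\notin Q$, $X_Q\subset (Q\cup\{\#\})^{\mathbb Z^d}$ is the set of configurations in which at most one coordinate carries an element of $Q$; for $q\in Q$ and $\vec v\in\mathbb Z^d$, $q[\vec v]\in X_Q$ is the unique configuration with value $q$ at $\vec v$. Translation: $\tau_{\vec v}(x)_{\vec w}=x_{\vec w+\vec v}$. A $d$-dimensional Turing machine is $M=(Q,\Sigma,N,\delta)$ with $Q$ a finite nonempty state set, $\Sigma$ a finite alphabet, $N\subset\mathbb Z^d$ finite, and $\delta:Q\times\Sigma^N\to Q\times\Sigma^N\times N$. In the moving head model, $M$ is the self-map of $X_Q\times\Sigma^{\mathbb Z^d}$ (with the topology inherited from the product topology over discrete alphabets) given by $M(\#^{\mathbb Z^d},x)=(\#^{\mathbb Z^d},x)$ and $M(q[\vec v],x)=(p[\vec v+\vec w],y)$, where $\delta(q,\tau_{\vec v}(x)|_N)=(p,P,\vec w)$ and $y$ is obtained from $x$ by replacing the contents of $N+\vec v$ with $P$. $M$ is reversible if this map is bijective. A continuous map $T:X\to X$ is mixing of all finite orders if for every $k\ge1$ and all nonempty open sets $U_0,\dots,U_k\subset X$ there exists $n_0\in\mathbb N$ such that for all integers $0=t_0<t_1<\dots<t_k$ with $t_{i+1}-t_i\ge n_0$ for all $i$, one has $\bigcap_{i=0}^k T^{-t_i}(U_i)\neq\emptyset$. *)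

(* Defs.v *)
From mathcomp Require Export all_boot all_order all_algebra.
From mathcomp Require Export finmap.
From mathcomp Require Export all_classical topology.

Set Implicit Arguments.
Unset Strict Implicit.
Unset Printing Implicit Defensive.

Import GRing.Theory.
Local Open Scope classical_set_scope.
Local Open Scope ring_scope.

Notation zlattice d := 'rV[int]_d.

(* [None] plays the role of the blank symbol #. *)
Definition at_most_one_head (d : nat) (Q : finType) :
    set {ptws zlattice d -> discrete_topology (option Q)} :=
  [set h | forall v w, h v <> None -> h w <> None -> v = w].

(* As a set coerced to a type, it carries the subspace topology of the
   product of discrete spaces. *)
Definition head_space (d : nat) (Q : finType) : topologicalType :=
  @at_most_one_head d Q : Type.

Definition tape_space (d : nat) (Sigma : finType) : topologicalType :=
  {ptws zlattice d -> discrete_topology Sigma}.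

Section Heads.
Variables (d : nat) (Q : finType).

Lemma at_most_one_head_none : at_most_one_head (fun _ : zlattice d => @None Q).
Proof. by move=> v w /(_ erefl). Qed.

Definition no_head : head_space d Q := SigSub (mem_set at_most_one_head_none).

Lemma at_most_one_head_at (q : Q) (v : zlattice d) :
  at_most_one_head (fun u => if u == v then Some q else None).
Proof.
move=> u w; case: (eqVneq u v) => [->|_] /=; last by move=> /(_ erefl).
by case: (eqVneq w v) => [->//|_] _ /(_ erefl).
Qed.

Definition head_at (q : Q) (v : zlattice d) : head_space d Q :=
  SigSub (mem_set (@at_most_one_head_at q v)).

Definition locate_head (h : head_space d Q) : option (Q * zlattice d) :=
  if pselect (exists qv : Q * zlattice d, val h qv.2 = Some qv.1) is left e
  then Some (projT1 (cid e)) else None.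

Lemma locate_no_head : locate_head no_head = None.
Proof. by rewrite /locate_head; case: pselect => // -[]. Qed.

Lemma locate_head_at q v : locate_head (head_at q v) = Some (q, v).
Proof.
rewrite /locate_head; case: pselect => [e|]; last first.
  by case; exists (q, v); rewrite /= eqxx.
case: (cid e) => -[p w] /=.
by case: (eqVneq w v) => [->|//] [->].
Qed.

Lemma head_spaceP (h : head_space d Q) :
  h = no_head \/ exists q v, h = head_at q v.
Proof.
have [[[q v] /= hv]|nh] := pselect (exists qv : Q * zlattice d, val h qv.2 = Some qv.1).
  right; exists q, v; apply: val_inj; apply/funext => u /=.
  case: (eqVneq u v) => [->//|uv].
  case E: (val h u) => [p|//].
  have /set_mem H := valP h.
  have uv' : u = v by apply: H => [/(etrans (esym E))|/(etrans (esym hv))].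
  by rewrite uv' eqxx in uv.
left; apply: val_inj; apply/funext => u /=.
case E: (val h u) => [p|//].
by case: nh; exists (p, u).
Qed.

End Heads.

(* The alphabet is required to be nonempty: with [tm_symbol] empty, a machine
   with nonempty neighborhood would act on the empty space, where every
   recurrence property holds vacuously. *)
Record turing_machine (d : nat) := TuringMachine {
  tm_state : finType;
  tm_state_nonempty : (0 < #|tm_state|)%N;
  tm_symbol : finType;
  tm_symbol_nonempty : (0 < #|tm_symbol|)%N;
  tm_nbhd : {fset zlattice d};
  tm_delta : tm_state * {ffun tm_nbhd -> tm_symbol} ->
             tm_state * {ffun tm_nbhd -> tm_symbol} * tm_nbhd
}.

Definition translate (d : nat) (A : Type) (v : zlattice d)
  (x : zlattice d -> A) : zlattice d -> A := fun w => x (w + v).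

Definition restrict (d : nat) (A : Type) (N : {fset zlattice d})
  (x : zlattice d -> A) : {ffun N -> A} := [ffun n : N => x (val n)].

Definition overwrite (d : nat) (A : Type) (N : {fset zlattice d})
    (v : zlattice d) (P : {ffun N -> A}) (x : zlattice d -> A) :
    zlattice d -> A :=
  fun u => if insub (u - v) is Some n then P n else x u.

Section MovingHead.
Variables (d : nat) (M : turing_machine d).

Definition moving_head_space : topologicalType :=
  (head_space d (tm_state M) * tape_space d (tm_symbol M))%type.

Definition moving_head (c : moving_head_space) : moving_head_space :=
  if locate_head c.1 is Some (q, v) then
    let: (p, P, w) := tm_delta (q, restrict (tm_nbhd M) (translate v c.2)) in
    (head_at p (v + val w), overwrite v P c.2)
  else c.

Lemma moving_head_no_head x : moving_head (no_head _ _, x) = (no_head _ _, x).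
Proof. by rewrite /moving_head locate_no_head. Qed.

Lemma moving_head_at q v x p P w :
    tm_delta (q, restrict (tm_nbhd M) (translate v x)) = (p, P, w) ->
  moving_head (head_at q v, x) = (head_at p (v + val w), overwrite v P x).
Proof. by rewrite /moving_head locate_head_at /= => ->. Qed.

Definition reversible : Prop := bijective moving_head.

End MovingHead.

Definition mixing_of_all_finite_orders (X : topologicalType) (T : X -> X) :
    Prop :=
  continuous T /\
  forall (k : nat) (U : 'I_k.+1 -> set X), (1 <= k)%N ->
    (forall i, open (U i) /\ U i !=set0) ->
    exists n0 : nat, forall t : nat -> nat,
      t 0%N = 0%N ->
      (forall i, (i < k)%N -> (t i < t i.+1)%N /\ (n0 <= t i.+1 - t i)%N) ->
      \bigcap_(i in [set: 'I_k.+1]) (iter (t i) T @^-1` U i) !=set0.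

(* Main.v *)
(** In dimension 3, let states and symbols be the same five directions; the head
    swaps the carried symbol with the symbol of its cell and moves along the
    symbol it now carries.  So every symbol is a particle that moves by its own
    vector whenever it is picked, and reversal of time is, up to reflection of
    space, the machine itself.

    Over the background where all cells contain the upward direction [dU], take
    finitely many other particles.  The horizontal parts of their vectors point
    in three pairwise non-opposite directions, so the head picks only finitely
    many of them before it leaves upward for ever; entering again from below,
    repeatedly, disperses all of them as far as desired along their three rays.
    Reversing time, any window pattern is assembled from particles that come from
    far away along the three opposite rays.  As the six rays are disjoint far
    away, the histories of several prescribed windows can be superposed in one
    tape.

    It remains to lead the head from above the box in which this happens back
    below it.  Each such route turns into a private plane outside the box, where
    its length can be adjusted: the relations [dW + dY + dD = 0]
    (3 steps) and [dX + dY + dD + dU = 0] (4 steps) between the five vectors give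
    every large duration, independently of the other routes. *)
From Stdlib Require Import ZArith Lia.
Require Import Defs.
From HB Require Import structures.
From mathcomp Require Import zify ssrZ.
Set Implicit Arguments.
Unset Strict Implicit.
Unset Printing Implicit Defensive.
Import GRing.Theory.
Local Open Scope Z_scope.

(** * The particle machine *)

Inductive dir := dU | dX | dW | dY | dD.

Record pos := Pos { px : Z; py : Z; pz : Z }.

Definition vec (t : dir) : pos :=
  match t with
  | dU => Pos 0 0 1
  | dX => Pos 1 0 0
  | dW => Pos 1 0 1
  | dY => Pos 0 1 0
  | dD => Pos (-1) (-1) (-1)
  end.

Definition padd (u v : pos) := Pos (px u + px v) (py u + py v) (pz u + pz v).
Definition popp (u : pos) := Pos (- px u) (- py u) (- pz u).

Lemma dir_eq_dec (s t : dir) : {s = t} + {s <> t}.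
Proof. by case: s; case: t; (left; reflexivity) || (right; discriminate). Defined.

Lemma pos_eq_dec (u v : pos) : {u = v} + {u <> v}.
Proof.
case: u v => [a b c] [a' b' c'].
case: (Z.eq_dec a a') => [->|ne]; last by right; case.
case: (Z.eq_dec b b') => [->|ne]; last by right; case.
case: (Z.eq_dec c c') => [->|ne]; last by right; case.
by left.
Qed.

Lemma posP (u v : pos) : px u = px v -> py u = py v -> pz u = pz v -> u = v.
Proof. by case: u v => [a b c] [a' b' c'] /= -> -> ->. Qed.

Lemma poppK u : popp (popp u) = u.
Proof. by apply: posP => /=; lia. Qed.

Definition tape := pos -> dir.

Definition upd (x : tape) (v : pos) (s : dir) : tape :=
  fun u => if pos_eq_dec u v then s else x u.

Lemma upd_same x v s : upd x v s v = s.
Proof. by rewrite /upd; case: pos_eq_dec. Qed.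

Lemma upd_other x v s u : u <> v -> upd x v s u = x u.
Proof. by rewrite /upd; case: pos_eq_dec. Qed.

Lemma upd_upd x v s t : upd (upd x v s) v t = upd x v t.
Proof. by apply/funext => u; rewrite /upd; case: pos_eq_dec. Qed.

Lemma upd_id x v s : x v = s -> upd x v s = x.
Proof.
move=> <-; apply/funext => u; rewrite /upd.
by case: pos_eq_dec => //= ->.
Qed.

Lemma upd_comm x u v s t :
  u <> v -> upd (upd x u s) v t = upd (upd x v t) u s.
Proof.
move=> ne; apply/funext => w; rewrite /upd.
by case: (pos_eq_dec w v) => //= ->; case: (pos_eq_dec v u) => //= e; case: ne.
Qed.

Record conf := Conf { st : dir; hd : pos; tp : tape }.

Definition step (c : conf) : conf :=
  let t := tp c (hd c) in Conf t (padd (hd c) (vec t)) (upd (tp c) (hd c) (st c)).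

(** Only the cells that are read and rewritten must satisfy [P]; the final head position is free, so
    runs through different regions concatenate. *)
Inductive steps (P : pos -> Prop) : nat -> conf -> conf -> Prop :=
| steps0 c : steps P 0 c c
| stepsS n c c' : P (hd c) -> steps P n (step c) c' -> steps P n.+1 c c'.

Lemma steps_iter P n c c' : steps P n c c' -> c' = iter n step c.
Proof. by elim=> // {}n {}c {}c' _ _ ->; rewrite iterSr. Qed.

Lemma steps_cat P m n c c' c'' :
  steps P m c c' -> steps P n c' c'' -> steps P (m + n)%N c c''.
Proof.
elim=> [//|{}m {}c {}c' Pc _ IH] /IH; rewrite addSn.
exact: stepsS.
Qed.

Lemma steps_mono (P Q : pos -> Prop) n c c' :
  (forall u, P u -> Q u) -> steps P n c c' -> steps Q n c c'.
Proof. by move=> PQ; elim=> [?|{}n {}c {}c' /PQ Pc _]; [exact: steps0|exact: stepsS]. Qed.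

Lemma steps_off P n c c' u : steps P n c c' -> ~ P u -> tp c' u = tp c u.
Proof.
elim=> // {}n {}c {}c' Pc _ IH nP; rewrite IH //= upd_other // => e.
by rewrite e in nP.
Qed.

Lemma steps_invariant (I : conf -> Prop) P n c c' :
  (forall c, I c -> I (step c)) -> steps P n c c' -> I c -> I c'.
Proof. by move=> II; elim=> // {}n {}c {}c' _ _ IH /II. Qed.

Definition pbox (r : Z) (u : pos) :=
  [/\ -r <= px u <= r, -r <= py u <= r & -r <= pz u <= r].

Lemma pbox_mono r s u : r <= s -> pbox r u -> pbox s u.
Proof. by move=> rs [? ? ?]; split; lia. Qed.

Lemma pbox_pos u : exists r, 0 <= r /\ pbox r u.
Proof.
by exists (Z.abs (px u) + Z.abs (py u) + Z.abs (pz u)); rewrite /pbox; split; [|split]; lia.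
Qed.

Lemma steps_bounded P n c c' :
  steps P n c c' -> exists r, steps (fun u => P u /\ pbox r u) n c c'.
Proof.
elim=> [{}c|{}n {}c {}c' Pc _ [r IH]]; first by exists 0; exact: steps0.
have [s [s0 hs]] := pbox_pos (hd c).
exists (Z.max r s); apply: stepsS; first by split=> //; apply: pbox_mono hs; lia.
by apply: steps_mono IH => u [Pu hu]; split=> //; apply: pbox_mono hu; lia.
Qed.

(* Reversal of time: the head is moved back along its symbol and space is
   reflected through the origin. *)
Definition ntape (x : tape) : tape := fun u => x (popp u).
Definition reverse (c : conf) : conf :=
  Conf (st c) (popp (padd (hd c) (popp (vec (st c))))) (ntape (tp c)).

Lemma ntapeK x : ntape (ntape x) = x.
Proof. by apply/funext => u; rewrite /ntape poppK. Qed.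

Lemma reverseK c : reverse (reverse c) = c.
Proof. by case: c => s v x; rewrite /reverse /= ntapeK; congr Conf; apply: posP => /=; lia. Qed.

Lemma ntape_upd x v s : ntape (upd x v s) = upd (ntape x) (popp v) s.
Proof.
apply/funext => u; rewrite /ntape /upd.
case: (pos_eq_dec u (popp v)) => [e|ne] /=; first by case: pos_eq_dec => //= ne; case: ne; rewrite e poppK.
by case: pos_eq_dec => // e; case: ne; rewrite -e poppK.
Qed.

Lemma hd_rev_step c : hd (reverse (step c)) = popp (hd c).
Proof. by apply: posP => /=; lia. Qed.

(** After a step the carried symbol is the one just read. Moving back along it leads to the
    rewritten cell, where the old symbol lies; swapping again restores the tape, and the reflected
    move along the old symbol ends at the head of [reverse c]. *)
Lemma step_rev c : step (reverse (step c)) = reverse c.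
Proof.
rewrite {1}/step hd_rev_step; case: c => s v x /=.
have -> : ntape (upd x v s) (popp v) = s by rewrite /ntape poppK upd_same.
rewrite /reverse /= ntape_upd upd_upd upd_id; last by rewrite /ntape poppK.
by congr Conf; apply: posP => /=; lia.
Qed.

Lemma steps_rev P n c c' :
  steps P n c c' -> steps (fun u => P (popp u)) n (reverse c') (reverse c).
Proof.
elim=> [{}c|{}n {}c {}c' Pc _ IH]; first exact: steps0.
rewrite -addn1; apply: steps_cat IH _.
apply: stepsS; first by rewrite hd_rev_step poppK.
by rewrite step_rev; exact: steps0.
Qed.

(* Superposition of two perturbations of the all-[dU] tape. *)
Definition overlay (x y : tape) : tape := fun u => if x u is dU then y u else x u.

Lemma steps_supl P n c c' y :
  (forall u, P u -> y u = dU) -> steps P n c c' ->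
  steps P n (Conf (st c) (hd c) (overlay (tp c) y)) (Conf (st c') (hd c') (overlay (tp c') y)).
Proof.
move=> yU; elim=> [{}c|{}n {}c {}c' Pc _ IH]; first exact: steps0.
apply: stepsS => //; move: IH; rewrite /step /=.
have -> : overlay (tp c) y (hd c) = tp c (hd c).
  by rewrite /overlay; case: (tp c (hd c)) (yU _ Pc).
suff -> : upd (overlay (tp c) y) (hd c) (st c) = overlay (upd (tp c) (hd c) (st c)) y by [].
apply/funext => u; rewrite /overlay /upd.
by case: pos_eq_dec => //= ->; case: (st c) (yU _ Pc).
Qed.

Lemma steps_supr P n c c' x :
  (forall u, P u -> x u = dU) -> steps P n c c' ->
  steps P n (Conf (st c) (hd c) (overlay x (tp c))) (Conf (st c') (hd c') (overlay x (tp c'))).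
Proof.
move=> xU; elim=> [{}c|{}n {}c {}c' Pc _ IH]; first exact: steps0.
apply: stepsS => //; move: IH; rewrite /step /=.
have -> : overlay x (tp c) (hd c) = tp c (hd c) by rewrite /overlay (xU _ Pc).
suff -> : upd (overlay x (tp c)) (hd c) (st c) = overlay x (upd (tp c) (hd c) (st c)) by [].
apply/funext => u; rewrite /overlay /upd.
by case: pos_eq_dec => //= ->; rewrite xU.
Qed.

(** * Straight runs *)

Definition pscale (k : Z) (u : pos) := Pos (k * px u) (k * py u) (k * pz u).

Lemma pscale0 v w : padd v (pscale 0 w) = v.
Proof. by apply: posP; cbn [padd pscale px py pz]; ring. Qed.

Lemma pscaleS v w k :
  padd v (pscale (Z.of_nat k.+1) w) = padd (padd v w) (pscale (Z.of_nat k) w).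
Proof. by rewrite Nat2Z.inj_succ; apply: posP; cbn [padd pscale px py pz]; ring. Qed.

(** Each cell after the first receives the symbol picked from its predecessor, which is again [t],
    so only the first cell changes. *)
Lemma straight P t k s v x :
  (forall i : nat, (i < k.+1)%N -> x (padd v (pscale (Z.of_nat i) (vec t))) = t
                 /\ P (padd v (pscale (Z.of_nat i) (vec t)))) ->
  steps P k.+1 (Conf s v x)
    (Conf t (padd v (pscale (Z.of_nat k.+1) (vec t))) (upd x v s)).
Proof.
elim: k s v x => [|k IH] s v x H.
  have [|xv Pv] := H 0%N; first by [].
  rewrite pscale0 in xv Pv; apply: stepsS => //; rewrite /step; cbn [st hd tp].
  rewrite xv pscaleS pscale0.
  exact: steps0.
have [|xv Pv] := H 0%N; first by [].
rewrite pscale0 in xv Pv.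
apply: stepsS => //; rewrite /step; cbn [st hd tp]; rewrite xv.
have H' (i : nat) : (i < k.+1)%N ->
    upd x v s (padd (padd v (vec t)) (pscale (Z.of_nat i) (vec t))) = t /\
    P (padd (padd v (vec t)) (pscale (Z.of_nat i) (vec t))).
  move=> ik; have [|xi Pi] := H i.+1; first by lia.
  rewrite -pscaleS; split=> //; rewrite upd_other // => e.
  have := (f_equal px e, f_equal py e, f_equal pz e).
  by clear; case: t; rewrite /padd /pscale; cbn [px py pz vec] => -[[a b] c]; lia.
have := IH t (padd v (vec t)) (upd x v s) H'.
by have [e _] := H' 0%N isT; rewrite pscale0 in e; rewrite -pscaleS (upd_id e).
Qed.

(** * The head escapes upward *)

(** Horizontal progress along the ray of [t]; [dX] and [dW] share their horizontal part. *)
Definition prog (t : dir) (u : pos) : Z :=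
  match t with dY => py u | dD => - px u | _ => px u end.

(* The column reached by a particle of symbol [t] that starts over the square
   of radius [n]. *)
Definition out (n : Z) (t : dir) (u : pos) : Prop :=
  match t with
  | dU => True
  | dX | dW => -n <= px u /\ -n <= py u <= n
  | dY => -n <= px u <= n /\ -n <= py u
  | dD => px u <= n /\ py u <= n /\ - (n + n) <= px u - py u <= n + n
  end.

Definition outcol (n : Z) (u : pos) := out n dX u \/ out n dY u \/ out n dD u.

Definition good_tape (n : Z) (x : tape) := forall u, out n (x u) u.

Definition good (n : Z) (c : conf) :=
  [/\ good_tape n (tp c), outcol n (hd c) & out n (st c) (hd c)].

(** A symbol picked in its own region stays there under its vector, and a carried symbol is dropped
    at a column of its region. *)
Lemma good_step n c : good n c -> good n (step c).
Proof.
case: c => s v x [/= gx gv gs]; have := gx v; rewrite /step /=.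
move=> gt; split=> /=.
- by move=> u; rewrite /upd; case: pos_eq_dec => //= ->.
- by move: gt gv; rewrite /outcol /out; case: (x v) => /=; lia.
- by move: gt; rewrite /out; case: (x v) => //=; lia.
Qed.

(** The number of picks that bring the particle beyond [L], since each pick raises [prog] by one. *)
Definition weight (L : Z) (u : pos) (t : dir) : nat :=
  if t is dU then 0%N else Z.to_nat (L + 1 - prog t u).

Lemma weight_move L u t : (weight L (padd u (vec t)) t <= weight L u t)%N.
Proof. by rewrite /weight; case: t => //=; lia. Qed.

Lemma weight_move_lt L u t : t <> dU -> prog t u <= L ->
  (weight L (padd u (vec t)) t < weight L u t)%N.
Proof. by rewrite /weight; case: t => //=; lia. Qed.

(* Records together that the support of [x] is finite and its total weight [k]. *)
Inductive pot (L : Z) : tape -> nat -> Prop :=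
| pot0 : pot L (fun _ => dU) 0
| potS x k v s : pot L x k -> x v = dU -> pot L (upd x v s) (k + weight L v s).

Lemma pot_remove L x k v : pot L x k ->
  exists k', pot L (upd x v dU) k' /\ k = (k' + weight L v (x v))%N.
Proof.
elim=> [|{}x {}k u s px [k' [pk' ek]] xu].
  exists 0%N; split=> //; have -> : upd (fun _ => dU) v dU = (fun _ => dU).
    by apply: upd_id.
  exact: pot0.
have [e|ne] := pos_eq_dec u v.
  rewrite e in xu *; exists k; rewrite upd_upd upd_id // upd_same; split=> //.
exists (k' + weight L u s)%N; rewrite upd_comm // upd_other; last by move=> e; case: ne.
split; last by rewrite ek; lia.
by apply: potS => //; rewrite upd_other.
Qed.

Definition cpot (L : Z) (c : conf) (k : nat) :=
  exists k0, pot L (tp c) k0 /\ k = (k0 + weight L (hd c) (st c))%N.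

(** Exchanging the carried particle with the one read keeps the total; the move then advances the
    picked particle. *)
Lemma cpot_step L c k : cpot L c k -> exists k', [/\ cpot L (step c) k', (k' <= k)%N &
  tp c (hd c) <> dU -> prog (tp c (hd c)) (hd c) <= L -> (k' < k)%N].
Proof.
case: c => s v x [k0 [/= pk0 ->]].
have [k1 [pk1 ->]] := pot_remove v pk0.
have := potS s pk1 (upd_same _ _ _); rewrite upd_upd => pk2.
exists (k1 + weight L v s + weight L (padd v (vec (x v))) (x v))%N; split.
- by exists (k1 + weight L v s)%N.
- by have := weight_move L v (x v); lia.
- by move=> t0 tL; have := weight_move_lt t0 tL; lia.
Qed.

Lemma pot_finite L x k : pot L x k ->
  exists l : seq pos, forall u, x u <> dU -> List.In u l.
Proof.
elim=> [|{}x {}k v s _ [l H] _]; first by exists [::].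
exists (v :: l) => u; rewrite /upd; case: pos_eq_dec => /= [->|_ /H]; by [left|right].
Qed.

Definition clear_above (x : tape) (v : pos) :=
  forall i, 0 <= i -> x (padd v (Pos 0 0 i)) = dU.

(** From [c'] on the head rises for ever and leaves the tape unchanged. *)
Definition settles (P : pos -> Prop) (c : conf) :=
  exists N c', [/\ steps P N c c', st c' = dU & clear_above (tp c') (hd c')].

Lemma settles_step (P : pos -> Prop) c : P (hd c) -> settles P (step c) -> settles P c.
Proof. by move=> Pc [N [c' [? ? ?]]]; exists N.+1, c'; split=> //; apply: stepsS. Qed.

Section Settle.
Variables (P : pos -> Prop) (I : conf -> nat -> Prop).
Hypothesis I_P : forall c k, I c k -> P (hd c).
Hypothesis I_dU : forall c k, I c k -> tp c (hd c) = dU ->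
  exists k', (k' <= k)%N /\ I (step c) k'.
Hypothesis I_pick : forall c k, I c k -> tp c (hd c) <> dU ->
  settles P (step c) \/ exists k', (k' < k)%N /\ I (step c) k'.

(** Carrying [dU] through cells with [dU] changes nothing, so the head has a clear column above it
    or climbs to the next particle. Each such pick lowers the measure unless the run settles after
    it. *)
Lemma settle k c : I c k -> settles P c.
Proof.
elim/ltn_ind: k c => k IH c Ic.
have pick d k' : (k' <= k)%N -> I d k' -> tp d (hd d) <> dU -> settles P d.
  move=> k'k Id hd_d; apply: settles_step; first exact: I_P Id.
  by case: (I_pick Id hd_d) => // -[k'' [lt]]; apply: IH; lia.
have key j d k' : (k' <= k)%N -> I d k' -> st d = dU ->
    tp d (padd (hd d) (pscale (Z.of_nat j) (Pos 0 0 1))) <> dU -> settles P d.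
  elim: j d k' => [|j IHj] d k' k'k Id sd.
    by rewrite pscale0; apply: pick Id.
  rewrite pscaleS => h.
  case: (dir_eq_dec (tp d (hd d)) dU) => hd_d; last exact: pick Id hd_d.
  apply: settles_step; first exact: I_P Id.
  have [k'' [le Id']] := I_dU Id hd_d.
  by apply: (IHj _ k'') => //; [lia|rewrite /step /= hd_d sd upd_id].
case: (dir_eq_dec (tp c (hd c)) dU) => hd_c; last exact: pick Ic hd_c.
apply: settles_step; first exact: I_P Ic.
have [k' [le Ic']] := I_dU Ic hd_c.
have [clr|nclr] := EM (clear_above (tp (step c)) (hd (step c))).
  by exists 0%N, (step c); split=> //; exact: steps0.
have [i /not_implyP [i0 hi]] := (existsNP _).2 nclr.
apply: (key (Z.to_nat i) _ k') => //.
move: hi; congr (~ (tp _ _ = dU)); apply: posP => /=; lia.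
Qed.

End Settle.

Definition ahead (t : dir) (v u : pos) : bool :=
  (prog t v <? prog t u) || (prog t v =? prog t u) && (pz v <=? pz u).

Lemma aheadP t v u :
  reflect (prog t v < prog t u \/ prog t v = prog t u /\ pz v <= pz u) (ahead t v u).
Proof. by apply: (iffP idP); rewrite /ahead; lia. Qed.

Lemma count_lt (T : Type) (p q : T -> bool) (l : seq T) v :
  (forall u, p u -> q u) -> List.In v l -> q v -> ~~ p v -> (count p l < count q l)%N.
Proof.
move=> pq; elim: l => //= a l IH [->|vl] qv pv.
  by rewrite qv (negbTE pv) ltnS add0n; apply: sub_count.
by have := IH vl qv pv; have := pq a; case: (p a) => // [->|_] //; case: (q a); lia.
Qed.

(** Where the progress along [k] exceeds [n], the bounds defining [out] exclude every particle of
    another class; [dX] and [dW] form one class. *)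
Lemma same_class n k t u : out n t u -> t <> dU -> k <> dU -> prog k u > n ->
  prog k =1 prog t.
Proof. by case: t; case: k => //= ? ? ? ? ?; lia. Qed.

Lemma outcol_good n c : good n c -> outcol n (hd c).
Proof. by case. Qed.

(** Beyond [n] only [dU] and symbols of the class of [k] are met, so the head strictly advances in
    the lexicographic order [ahead] and never revisits a cell. The measure counts the cells of [l]
    still ahead. *)
Lemma settles_sector n k c l : good n c -> k <> dU -> prog k (hd c) > n ->
  (forall u, tp c u <> dU -> List.In u l) -> settles (outcol n) c.
Proof.
move=> gc k0 kc hl.
pose I c m := [/\ good n c, prog k (hd c) > n,
  forall u, ahead k (hd c) u -> tp c u <> dU -> List.In u l & m = count (ahead k (hd c)) l].
have ahead_step d : good n d -> prog k (hd d) > n ->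
    [/\ prog k (hd (step d)) > n,
     forall u, ahead k (hd (step d)) u -> ahead k (hd d) u & ~~ ahead k (hd (step d)) (hd d)].
  move=> [gx _ _] kd; have := gx (hd d).
  rewrite /step /=; case: (dir_eq_dec (tp d (hd d)) dU) => [->|t0] ot.
    split.
    - by move: kd k0; case: (k) => //=; lia.
    - by move=> u /aheadP /= H; apply/aheadP; move: H; case: (k) => //=; lia.
    - by apply/aheadP => /= H; move: H k0; case: (k) => //=; lia.
  have e := same_class ot t0 k0 kd; rewrite e in kd.
  by split=> [|u|]; rewrite /ahead !{}e; move: t0 kd {ot};
    case: (tp d (hd d)) => //= _ kd; lia.
have Istep d m : I d m -> exists m', [/\ (m' <= m)%N, I (step d) m' &
    tp d (hd d) <> dU -> (m' < m)%N].
  move=> [gd kd hd_l ->]; have [kd' sub nsub] := ahead_step d gd kd.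
  exists (count (ahead k (hd (step d))) l); split.
  - exact: sub_count.
  - split=> //; first exact: good_step.
    move=> u au; rewrite /step /= upd_other; first exact: hd_l (sub _ au).
    by move=> eu; rewrite -eu au in nsub.
  - move=> t0; have dd : ahead k (hd d) (hd d) by apply/aheadP; right; lia.
    by apply: (count_lt _ _ dd) => //; exact: hd_l.
apply: (@settle _ I _ _ _ (count (ahead k (hd c)) l)).
- by move=> d m [/outcol_good].
- by move=> d m /Istep [m' [? ? _]] _; exists m'.
- by move=> d m /Istep [m' [_ ? lt]] /lt ?; right; exists m'.
- by split=> // u _; exact: hl.
Qed.

Lemma cpot_finite L c k : cpot L c k ->
  exists l : seq pos, forall u, tp c u <> dU -> List.In u l.
Proof. by move=> [k0 [/pot_finite]]. Qed.

(** A pick at progress at most [n] lowers the weight; a pick beyond [n] puts the head into a sector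
    with finitely many particles. *)
Lemma good_settles n c k : good n c -> cpot n c k -> settles (outcol n) c.
Proof.
move=> gc pc.
apply: (@settle _ (fun c k => good n c /\ cpot n c k) _ _ _ k) => //.
- by move=> d m [/outcol_good].
- move=> d m [gd /cpot_step [m' [pm' le _]]] _; exists m'; split=> //.
  by split=> //; exact: good_step.
- move=> d m [gd /cpot_step [m' [pm' le lt]]] t0.
  case: (Z.le_gt_cases (prog (tp d (hd d)) (hd d)) n) => h.
    by right; exists m'; split; [exact: lt|split=> //; exact: good_step].
  left; have [l hl] := cpot_finite pm'.
  apply: (settles_sector (good_step gd) t0 _ hl).
  by rewrite /step /=; move: h t0; case: (tp d (hd d)) => //=; lia.
Qed.

(** * Dispersion of the particles *)

(** The heights [- R] and [R + 1] are exchanged by time reversal, which moves the head back along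
    [dU] before reflecting. *)
Definition entry (p : Z * Z) (R : Z) (g : tape) := Conf dU (Pos p.1 p.2 (- R)) g.
Definition exit (p : Z * Z) (R : Z) (g : tape) := Conf dU (Pos p.1 p.2 (R + 1)) g.

Definition inside (P : pos -> Prop) (R : Z) (u : pos) := P u /\ pbox R u.

Definition colr (r : Z) (u : pos) := -r <= px u <= r /\ -r <= py u <= r.

Definition matches (n : Z) (c d : conf) :=
  [/\ st d = st c, hd d = hd c & forall u, pbox n u -> tp d u = tp c u].

(** A marked run has the whole window in its region, so that a tape superposed off the region cannot
    disturb the window. *)
Definition crossing n (Q : pos -> Prop) (mk : option conf) (a b : conf) : Prop :=
  if mk is Some c then
    (forall u, pbox n u -> Q u) /\
    exists m1 m2 d, [/\ steps Q m1 a d, matches n c d & steps Q m2 d b]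
  else exists N, steps Q N a b.

Record item := Item { ent : Z * Z; ext : Z * Z; mark : option conf }.

(** Tapes and columns do not depend on [R], so the box can be fixed after all excursions have been
    composed. *)
Definition exc n P (g : tape) (i : item) (g' : tape) :=
  exists R0, forall R, R0 <= R ->
    crossing n (inside P R) (mark i) (entry (ent i) R g) (exit (ext i) R g').

Inductive chain n P : tape -> seq item -> tape -> Prop :=
| chain0 g : chain n P g [::] g
| chainS g i g1 l g' : exc n P g i g1 -> chain n P g1 l g' -> chain n P g (i :: l) g'.

Definition marks (l : seq item) : seq conf := pmap mark l.

Lemma inside_mono (P P' : pos -> Prop) R u :
  (forall u, P u -> P' u) -> inside P R u -> inside P' R u.
Proof. by move=> PP' [Pu ?]; split=> //; exact: PP'. Qed.

Lemma crossing_mono n (P Q : pos -> Prop) mk a b :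
  (forall u, P u -> Q u) -> crossing n P mk a b -> crossing n Q mk a b.
Proof.
move=> PQ; case: mk => [c [bP [m1 [m2 [d [s1 mt s2]]]]]|[N s]] /=.
  split=> [u /bP /PQ//|]; exists m1, m2, d.
  by split=> //; [exact: steps_mono s1|exact: steps_mono s2].
by exists N; exact: steps_mono s.
Qed.

Lemma crossing_steps n P mk a b : crossing n P mk a b -> exists N, steps P N a b.
Proof.
case: mk => [c [_ [m1 [m2 [d [s1 _ s2]]]]]|//].
by exists (m1 + m2)%N; exact: steps_cat s2.
Qed.

Definition lift_supl y c := Conf (st c) (hd c) (overlay (tp c) y).
Definition lift_supr x c := Conf (st c) (hd c) (overlay x (tp c)).

Lemma crossing_supl n P mk a b y : (forall u, P u -> y u = dU) ->
  crossing n P mk a b -> crossing n P mk (lift_supl y a) (lift_supl y b).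
Proof.
move=> yU; case: mk => [c [bP [m1 [m2 [d [s1 [e1 e2 e3] s2]]]]]|[N s]] /=; last first.
  by exists N; exact: steps_supl.
split=> //; exists m1, m2, (lift_supl y d); split; [exact: steps_supl| |exact: steps_supl].
split=> // u nu; rewrite /= /overlay -(e3 u nu).
by case: (tp d u) (yU _ (bP _ nu)).
Qed.

Lemma crossing_supr n P mk a b x : (forall u, P u -> x u = dU) ->
  crossing n P mk a b -> crossing n P mk (lift_supr x a) (lift_supr x b).
Proof.
move=> xU; case: mk => [c [bP [m1 [m2 [d [s1 [e1 e2 e3] s2]]]]]|[N s]] /=; last first.
  by exists N; exact: steps_supr.
split=> //; exists m1, m2, (lift_supr x d); split; [exact: steps_supr| |exact: steps_supr].
by split=> // u nu; rewrite /= /overlay -(e3 u nu) xU //; exact: bP.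
Qed.

Lemma chain_mono n (P Q : pos -> Prop) g l g' :
  (forall u, P u -> Q u) -> chain n P g l g' -> chain n Q g l g'.
Proof.
move=> PQ; elim=> [?|{}g i g1 {}l {}g' [R0 H] _]; first exact: chain0.
apply: chainS; exists R0 => R /H; apply: crossing_mono => u; exact: inside_mono.
Qed.

Lemma chain_cat n P g l g1 l' g' :
  chain n P g l g1 -> chain n P g1 l' g' -> chain n P g (l ++ l') g'.
Proof.
by elim=> // {}g i g2 {}l {}g1 H _ IH /IH; exact: chainS.
Qed.

Lemma chain_supl n P g l g' y : (forall u, P u -> y u = dU) ->
  chain n P g l g' -> chain n P (overlay g y) l (overlay g' y).
Proof.
move=> yU; elim=> [?|{}g i g1 {}l {}g' [R0 H] _]; first exact: chain0.
apply: chainS; exists R0 => R /H; apply: crossing_supl => u [/yU//].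
Qed.

Lemma chain_supr n P g l g' x : (forall u, P u -> x u = dU) ->
  chain n P g l g' -> chain n P (overlay x g) l (overlay x g').
Proof.
move=> xU; elim=> [?|{}g i g1 {}l {}g' [R0 H] _]; first exact: chain0.
apply: chainS; exists R0 => R /H; apply: crossing_supr => u [/xU//].
Qed.

Lemma marks_cat l l' : marks (l ++ l') = marks l ++ marks l'.
Proof. exact: pmap_cat. Qed.

Definition bounded_tape (x : tape) := exists r, forall u, x u <> dU -> pbox r u.

Lemma steps_within_bounded P R n c c' :
  steps (inside P R) n c c' -> bounded_tape (tp c) -> bounded_tape (tp c').
Proof.
move=> s [r H]; exists (Z.max R r) => u ne.
have [[_ b]|nb] := EM (inside P R u); first by apply: pbox_mono b; lia.
by move: ne; rewrite (steps_off s nb) => /H; apply: pbox_mono; lia.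
Qed.

Lemma chain_bounded n P g l g' : chain n P g l g' -> bounded_tape g -> bounded_tape g'.
Proof.
elim=> // {}g i g1 {}l {}g' [R0 H] _ IH bg; apply: IH.
have [N s] := crossing_steps (H R0 (Z.le_refl _)).
exact: steps_within_bounded s bg.
Qed.

Lemma pot_bounded L x k : pot L x k -> bounded_tape x.
Proof.
elim=> [|{}x {}k v s _ [r H] _]; first by exists 0.
have [r' [r'0 hv]] := pbox_pos v; exists (Z.max r r') => u; rewrite /upd.
case: pos_eq_dec => /= [->|_ /H]; last by apply: pbox_mono; lia.
by move=> _; apply: pbox_mono hv; lia.
Qed.

Lemma bounded_sup x y : bounded_tape x -> bounded_tape y -> bounded_tape (overlay x y).
Proof.
move=> [r hx] [s hy]; exists (Z.max r s) => u; rewrite /overlay.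
have := hx u; have := hy u; case: (x u) => hyu hxu ne;
  try (by apply: (@pbox_mono r); [lia|exact: hxu]).
by apply: (@pbox_mono s); [lia|exact: hyu].
Qed.

Lemma pbox_popp r u : pbox r (popp u) <-> pbox r u.
Proof. by rewrite /pbox /=; split=> -[? ? ?]; split; lia. Qed.

Lemma bounded_ntape x : bounded_tape x -> bounded_tape (ntape x).
Proof. by move=> [r H]; exists r => u /H /pbox_popp. Qed.

Lemma rise (P : pos -> Prop) k a b z g :
  (forall i, z <= i < z + Z.of_nat k -> g (Pos a b i) = dU /\ P (Pos a b i)) ->
  steps P k (Conf dU (Pos a b z) g) (Conf dU (Pos a b (z + Z.of_nat k)) g).
Proof.
case: k => [|k] H; first by rewrite Z.add_0_r; exact: steps0.
have [|gz _] := H z; first by lia.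
have e j : padd (Pos a b z) (pscale j (vec dU)) = Pos a b (z + j).
  by apply: posP; cbn [padd pscale px py pz vec]; lia.
have := @straight P dU k dU (Pos a b z) g; rewrite (upd_id gz) e; apply.
by move=> i ik; rewrite e; apply: H; lia.
Qed.

Definition column_pred (P : pos -> Prop) :=
  forall u v, px u = px v -> py u = py v -> P u -> P v.

(** The part of an excursion after a mark; reversed in time, it also provides the part before a
    mark. *)
Definition half_exc P c p g :=
  exists R0, forall R, R0 <= R -> exists N, steps (inside P R) N c (exit p R g).

Lemma half_exc_core P N c c' : column_pred P -> steps P N c c' ->
  st c' = dU -> clear_above (tp c') (hd c') -> P (hd c') ->
  exists r, half_exc (fun u => P u /\ colr r u) c (px (hd c'), py (hd c')) (tp c').
Proof.
move=> cP /steps_bounded [r s] sc' clr Pc'.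
have [r' [r'0 hc']] := pbox_pos (hd c').
exists (Z.max r r'), (Z.max r r') => R rR.
have k0 : 0 <= R + 1 - pz (hd c') by case: hc'; lia.
exists (N + Z.to_nat (R + 1 - pz (hd c')))%N.
apply: (@steps_cat _ _ _ _ c').
  apply: steps_mono s => u [Pu [? ? ?]]; split; last by split; lia.
  by split=> //; rewrite /colr; lia.
case: c' sc' clr Pc' hc' k0 {s} => s [a b z] g /= -> clr Pc' [/= ? ? ?] k0.
have -> : exit (a, b) R g =
    Conf dU (Pos a b (z + Z.of_nat (Z.to_nat (R + 1 - z)))) g.
  by rewrite /exit /=; do 2 f_equal; lia.
apply: rise => i zi; split.
  have := clr (i - z); rewrite /padd /=.
  have -> : Pos (a + 0) (b + 0) (z + (i - z)) = Pos a b i by apply: posP => /=; lia.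
  by apply; lia.
split; last by split=> /=; lia.
by split; [exact: cP Pc'|rewrite /colr /=; lia].
Qed.

Lemma exc_core n P N a b z g c' : column_pred P ->
  steps P N (Conf dU (Pos a b z) g) c' ->
  (forall i, i < z -> g (Pos a b i) = dU) -> P (Pos a b z) ->
  st c' = dU -> clear_above (tp c') (hd c') -> P (hd c') ->
  exists r, exc n (fun u => P u /\ colr r u) g
    (Item (a, b) (px (hd c'), py (hd c')) None) (tp c').
Proof.
move=> cP s below Pc sc' clr Pc'.
have [r [R0 H]] := half_exc_core cP s sc' clr Pc'.
have [r' [r'0 hc]] := pbox_pos (Pos a b z).
exists (Z.max r r'), (Z.max R0 r') => R rR /=.
have [|N' s'] := H R; first by lia.
exists (Z.to_nat (z + R) + N')%N; case: hc => /= ? ? ?.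
apply: (@steps_cat _ _ _ _ (Conf dU (Pos a b z) g)); last first.
  apply: steps_mono s' => u [[Pu [? ?]] bu].
  by split=> //; split=> //; rewrite /colr; lia.
have e : Pos a b z = Pos a b (- R + Z.of_nat (Z.to_nat (z + R))).
  by f_equal; lia.
rewrite e; apply: rise => i ib; split; first by apply: below; lia.
split; last by split=> /=; lia.
by split; [exact: cP Pc|rewrite /colr /=; lia].
Qed.

Lemma colr_mono r s u : r <= s -> colr r u -> colr s u.
Proof. by rewrite /colr; lia. Qed.

Lemma outcol_column n : column_pred (outcol n).
Proof. by move=> u v eu ev; rewrite /outcol /out eu ev. Qed.

Lemma pot_change L L' x k : pot L x k -> exists k', pot L' x k'.
Proof.
elim=> [|{}x {}k v s _ [k' pk'] xv]; first by exists 0%N; exact: pot0.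
by exists (k' + weight L' v s)%N; exact: potS.
Qed.

Definition far (L : Z) (x : tape) := forall u, x u <> dU -> L < prog (x u) u.

Lemma lowest x a b z : bounded_tape x -> x (Pos a b z) <> dU ->
  exists z0, x (Pos a b z0) <> dU /\ forall i, i < z0 -> x (Pos a b i) = dU.
Proof.
move=> [r H] xz.
pose p j := if x (Pos a b (Z.of_nat j - r)) is dU then false else true.
have pE j : p j <-> x (Pos a b (Z.of_nat j - r)) <> dU.
  by rewrite /p; case: (x _); split.
have rE i : x (Pos a b i) <> dU -> Z.of_nat (Z.to_nat (i + r)) - r = i.
  by move=> /H [_ _ /=]; lia.
have pz : exists j, p j by exists (Z.to_nat (z + r)); apply/pE; rewrite rE.
case: (ex_minnP pz) => j /pE hj jmin; exists (Z.of_nat j - r); split=> // i ij.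
case: (dir_eq_dec (x (Pos a b i)) dU) => // xi.
have := jmin (Z.to_nat (i + r)); rewrite pE rE // => /(_ xi) le.
by have := rE i xi; lia.
Qed.

(** If [v] were beyond [L], both symbols would be of one class and would have equal progress in
    their common column. *)
Lemma prog_column n L t t' u v : n <= L -> px u = px v -> py u = py v ->
  out n t u -> out n t' v -> t <> dU -> t' <> dU -> prog t u <= L -> prog t' v <= L.
Proof. by move=> nL eu ev; case: t; case: t' => //=; lia. Qed.

Lemma good_steps n P N c c' : steps P N c c' -> good n c -> good n c'.
Proof. by apply: steps_invariant => d; exact: good_step. Qed.

Lemma cpot_steps L P N c c' k : steps P N c c' -> cpot L c k ->
  exists k', (k' <= k)%N /\ cpot L c' k'.
Proof.
move=> s pk; apply: (steps_invariant (I := fun d => exists k', (k' <= k)%N /\ cpot L d k') _ s).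
  by move=> d [k' [le /cpot_step [k'' [pk'' le' _]]]]; exists k''; split=> //; lia.
by exists k.
Qed.

Definition outr n r u := outcol n u /\ colr r u.

Lemma outr_mono n r s u : r <= s -> outr n r u -> outr n s u.
Proof. by move=> rs [? ?]; split=> //; exact: colr_mono rs _. Qed.

(** While some particle is not beyond [L], the head enters its column from below. By [prog_column]
    the lowest particle there is not beyond [L] either, so picking it lowers the total weight. *)
Lemma disperse n L k g : n <= L -> good_tape n g -> pot L g k ->
  exists r l g', [/\ chain n (outr n r) g l g', marks l = [::], good_tape n g' & far L g'].
Proof.
move=> nL; elim/ltn_ind: k g => k IH g gg pk.
have [fg|/existsNP [u /not_implyP [gu nfu]]] := EM (far L g).
  by exists 0, [::], g; split=> //; exact: chain0.
case: u gu nfu => a b z gz nfz.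
have [z0 [gz0 below]] := lowest (pot_bounded pk) gz.
pose c := Conf dU (Pos a b z0) g.
have oc : outcol n (Pos a b z0).
  have := gg (Pos a b z0); rewrite /outcol; case: (g (Pos a b z0)) gz0 => //=; tauto.
have gc : good n c by split.
have pc : cpot L c k by exists k; split=> //; rewrite /= addn0.
have [k1 [pk1 _ lt]] := cpot_step pc.
have {}lt : (k1 < k)%N.
  apply: lt => //=; apply: (prog_column nL _ _ (gg _) (gg _) gz gz0); rewrite //.
  by lia.
(* Settling is measured with threshold [n], the induction with threshold [L]. *)
have [k2 pk2] : exists k2, cpot n (step c) k2.
  case: pk1 => k3 [/(pot_change n) [k4 pk4] _].
  by exists (k4 + weight n (hd (step c)) (st (step c)))%N; exists k4.
have [N [c' [s sc' clr]]] := good_settles (good_step gc) pk2.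
have s' : steps (outcol n) N.+1 c c' by apply: stepsS.
have gc' := good_steps s' gc.
have [k5 [le5 [k6 [pk6 e6]]]] := cpot_steps s pk1.
have [r1 ex] := exc_core n (@outcol_column n) s' below oc sc' clr (outcol_good gc').
have [||r2 [l [g' [ch ml gg' fg']]]] := IH k6 _ (tp c') _ pk6; first by lia.
  by case: gc'.
exists (Z.max r1 r2), (Item (a, b) (px (hd c'), py (hd c')) None :: l), g'.
split=> //; apply: (@chainS _ _ _ _ (tp c')).
  case: ex => R0 H; exists R0 => R /H; apply: crossing_mono => v.
  by apply: inside_mono => w; apply: outr_mono; lia.
by apply: chain_mono ch => v; apply: outr_mono; lia.
Qed.

(** Applied to [reverse c], this also yields the past of a window. *)
Lemma forward n L c k : n <= L -> good n c -> pot n (tp c) k ->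
  exists r p g1 l g', [/\ half_exc (outr n r) c p g1, chain n (outr n r) g1 l g',
    marks l = [::] & [/\ bounded_tape g1, good_tape n g' & far L g']].
Proof.
move=> nL gc pk.
have pc : cpot n c (k + weight n (hd c) (st c))%N by exists k.
have [N [c' [s sc' clr]]] := good_settles gc pc.
have gc' := good_steps s gc.
have [r1 [R0 H]] := half_exc_core (@outcol_column n) s sc' clr (outcol_good gc').
have [k1 [_ [k2 [pk2 _]]]] := cpot_steps s pc.
have [k3 pk3] := pot_change L pk2.
have gt' : good_tape n (tp c') by case: gc'.
have [r2 [l [g' [ch ml gg' fg']]]] := disperse nL gt' pk3.
exists (Z.max r1 r2), (px (hd c'), py (hd c')), (tp c'), l, g'; split=> //.
- exists R0 => R /H [N' s']; exists N'; apply: steps_mono s' => v.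
  by apply: inside_mono => w; apply: outr_mono; lia.
- by apply: chain_mono ch => v; apply: outr_mono; lia.
- by split=> //; exact: pot_bounded pk2.
Qed.

(** * Superposition of the histories of several windows *)

Definition nent (p : Z * Z) : Z * Z := (- p.1, - p.2).

Lemma rev_exit p R g : reverse (exit p R g) = entry (nent p) R (ntape g).
Proof. by rewrite /reverse /entry /=; congr Conf; apply: posP => /=; lia. Qed.

Lemma rev_entry p R g : reverse (entry p R g) = exit (nent p) R (ntape g).
Proof. by rewrite /reverse /exit /=; congr Conf; apply: posP => /=; lia. Qed.

Lemma steps_within_rev P R n c c' :
  steps (inside P R) n c c' -> steps (inside (P \o popp) R) n (reverse c') (reverse c).
Proof.
by move=> /steps_rev; apply: steps_mono => u [Pu /pbox_popp].
Qed.

Lemma chain_rev n P g l g' : marks l = [::] -> chain n P g l g' ->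
  exists l', marks l' = [::] /\ chain n (P \o popp) (ntape g') l' (ntape g).
Proof.
move=> ml ch; elim: ch ml => [{}g _|{}g i g1 {}l {}g' [R0 H] _ IH].
  by exists [::]; split=> //; exact: chain0.
case: i H => p q [c|//] H // /IH [l' [ml' ch']].
exists (l' ++ [:: Item (nent q) (nent p) None]); split.
  by rewrite marks_cat ml'.
apply: chain_cat ch' _; apply: chainS; last exact: chain0.
exists R0 => R /H [N s] /=; exists N; rewrite -rev_exit -rev_entry.
exact: steps_within_rev.
Qed.

Lemma pot_ntape L x k : pot L x k -> exists k', pot L (ntape x) k'.
Proof.
elim=> [|{}x {}k v s _ [k' pk'] xv]; first by exists 0%N; exact: pot0.
exists (k' + weight L (popp v) s)%N; rewrite ntape_upd; apply: potS => //.
by rewrite /ntape poppK.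
Qed.

Definition target n c := [/\ good n c, good n (reverse c) & exists k, pot n (tp c) k].

(** Here [g] holds particles still to come, on rays opposite to the outgoing ones. Such a ray meets
    an outgoing region only at distances up to [3 * n], for instance the ray opposite to [dX] and
    the region of [dD]. *)
Lemma far_in_avoid n L r g u : 0 <= n -> 4 * n <= L -> r <= L ->
  good_tape n (ntape g) -> far L (ntape g) -> outcol n u \/ colr r u -> g u = dU.
Proof.
move=> n0 nL rL gg fg h; case: (dir_eq_dec (g u) dU) => // gu.
have := gg (popp u); have := fg (popp u); rewrite /ntape poppK => /(_ gu).
by move: h gu; rewrite /outcol /colr /out /=; case: (g u) => //= *; exfalso; lia.
Qed.

Lemma far_out_avoid n L r g u : 0 <= n -> r <= L -> far L g -> colr r u -> g u = dU.
Proof.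
move=> n0 rL fg h; case: (dir_eq_dec (g u) dU) => // gu.
by have := fg u gu; move: h; rewrite /colr; case: (g u) gu => //= *; exfalso; lia.
Qed.

Lemma far_mono L L' g : L <= L' -> far L' g -> far L g.
Proof. by move=> LL fg u /fg; lia. Qed.

Lemma far_sup L x y : far L (ntape x) -> far L (ntape y) -> far L (ntape (overlay x y)).
Proof.
move=> fx fy u; have := fx u; have := fy u; rewrite /ntape /overlay.
case: (x (popp u)) => hy hx ne; first exact: hy.
all: exact: hx.
Qed.

Lemma good_sup n x y :
  good_tape n (ntape x) -> good_tape n (ntape y) -> good_tape n (ntape (overlay x y)).
Proof.
move=> fx fy u; have := fx u; have := fy u; rewrite /ntape /overlay.
by case: (x (popp u)).
Qed.

(** The history of the first window is played while the particles of the later ones are still far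
    away on their incoming rays; its own particles end beyond all columns used later. *)
Lemma composite n cs : 0 <= n -> (forall c, List.In c cs -> target n c) ->
  forall L, exists r g l g', [/\ chain n (colr r) g l g', marks l = cs, bounded_tape g,
    good_tape n (ntape g) & far L (ntape g)].
Proof.
move=> n0; elim: cs => [|c cs IH] tcs L.
  exists 0, (fun=> dU), [::], (fun=> dU); split=> //; first exact: chain0.
  by exists 0.
have [gc grc [k pk]] : target n c by apply: tcs; left.
have {}IH := IH (fun d h => tcs d (or_intror h)).
have [k' pk'] := pot_ntape pk.
(* The order of choices matters: the past of [c] fixes [rB], the later particles start beyond [rB]
   and fix [r], and the future of [c] disperses its particles beyond [r]. *)
have [||rB [pB [gB [lB [iB [hB cB mB [bB giB fiB]]]]]]] :=
  @forward n (Z.max L n) (reverse c) k' _ grc; [by lia|exact: pk'|].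
have [r [g [l [g' [ch ml bg gg fg]]]]] := IH (Z.max L (Z.max rB (4 * n))).
have [||rF [pF [gF [lF [oF [hF cF mF [bF goF foF]]]]]]] :=
  @forward n (Z.max n r) c k _ gc; [by lia|exact: pk|].
have [lB' [mB' cB']] := chain_rev mB cB.
pose V u := outr n (Z.max rF n) u \/ outr n rB (popp u).
have midexc : exc n V (ntape gB) (Item (nent pB) pF (Some c)) gF.
  have [RB HB] := hB; have [RF HF] := hF.
  exists (Z.max n (Z.max RB RF)) => R hR /=.
  have [|NB sB] := HB R; first by lia.
  have [|NF sF] := HF R; first by lia.
  split.
    move=> u [? ? ?]; split; last by split; lia.
    by left; split; [left; rewrite /out; lia|rewrite /colr; lia].
  exists NB, NF, c; split=> //.
    have := steps_within_rev sB; rewrite rev_exit reverseK; apply: steps_mono => u.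
    by apply: inside_mono => v; right.
  apply: steps_mono sF => u; apply: inside_mono => v h; left.
  by apply: outr_mono h; lia.
have bigF : chain n V gF lF oF.
  by apply: chain_mono cF => u h; left; apply: outr_mono h; lia.
have bigB : chain n V (ntape iB) lB' (ntape gB).
  by apply: chain_mono cB' => u h; right.
have stage := chain_cat bigB (chainS midexc bigF).
(* As [rF] is chosen after [g], the forward part avoids [g] through [outcol n] alone; the backward
   part is bounded by [rB]. *)
have gV u : V u -> g u = dU.
  move=> Vu; apply: (far_in_avoid (r := rB) n0 _ _ gg fg); [lia|lia|].
  case: Vu => [[? _]|[_ h]]; first by left.
  by right; move: h; rewrite /colr /=; lia.
have oV u : colr r u -> oF u = dU.
  by apply: (far_out_avoid n0 _ foF); lia.
have ch1 := chain_supl gV stage; have ch2 := chain_supr oV ch.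
exists (Z.max r (Z.max (Z.max rF n) rB)), (overlay (ntape iB) g),
  ((lB' ++ Item (nent pB) pF (Some c) :: lF) ++ l), (overlay oF g'); split.
- apply: (chain_cat (g1 := overlay oF g)).
    apply: chain_mono ch1 => u; rewrite /V /outr /colr /=; lia.
  by apply: chain_mono ch2 => u; rewrite /colr; lia.
- by rewrite !marks_cat mB' /= /marks /= -/(marks lF) mF -/(marks l) ml.
- apply: bounded_sup bg; apply: bounded_ntape.
  exact: chain_bounded cB bB.
- by apply: good_sup gg; rewrite ntapeK.
- apply: far_sup; first by rewrite ntapeK; apply: far_mono fiB; lia.
  by apply: far_mono fg; lia.
Qed.

(** * Routes outside the box *)

(** The case [k = 0], where nothing is written, is included because [L i] may vanish. *)
Lemma segment P t s v k x : 0 <= k ->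
  (forall i, 0 <= i < k -> x (padd v (pscale i (vec t))) = t
                        /\ P (padd v (pscale i (vec t)))) ->
  exists s' x', [/\ steps P (Z.to_nat k) (Conf s v x)
                      (Conf s' (padd v (pscale k (vec t))) x'),
    forall u, u <> v \/ k = 0 -> x' u = x u & 0 < k -> s' = t /\ x' v = s].
Proof.
move=> k0 H; case: (Z.eq_dec k 0) => [->|kn0].
  by exists s, x; rewrite pscale0; split=> //; exact: steps0.
exists t, (upd x v s); split; last by rewrite upd_same.
  have -> : Z.to_nat k = (Z.to_nat k).-1.+1 by lia.
  have := @straight P t (Z.to_nat k).-1 s v x.
  have -> : Z.of_nat (Z.to_nat k).-1.+1 = k by lia.
  by apply=> i ik; apply: H; lia.
by move=> u [|//]; exact: upd_other.
Qed.

Lemma pos_ne u v : px u <> px v \/ py u <> py v \/ pz u <> pz v -> u <> v.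
Proof. by move=> h e; rewrite e in h; lia. Qed.

Section Routes.
Variables (R : Z) (M : nat) (X' Y' X Y H K L : nat -> Z).
Hypothesis R0 : 0 <= R.
Hypothesis bX' : forall i, (i < M)%N -> -R <= X' i <= R.
Hypothesis bY' : forall i, (i < M)%N -> -R <= Y' i <= R.
Hypothesis bX : forall i, (i < M)%N -> -R <= X i <= R.
Hypothesis bY : forall i, (i < M)%N -> -R <= Y i <= R.
Hypothesis bH : forall i, (i < M)%N -> R + 1 <= H i.
Hypothesis bK : forall i, (i < M)%N -> 5 * R + 5 <= K i.
Hypothesis bL : forall i, (i < M)%N -> 0 <= L i.
Hypothesis H_inj : forall i j, (i < M)%N -> (j < M)%N -> i <> j -> H i <> H j.
(** The rising column of [i] could meet the [dX] run of [j] only if [X' j <= X' i]. For smaller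
    [X' j] that run is above [H i]; for equal abscissas a run below belongs to an earlier route,
    whose turning cell holds [dU] by then. *)
Hypothesis H_X' : forall i j, (i < M)%N -> (j < M)%N -> X' i < X' j -> H j < H i.
Hypothesis H_same : forall i j, (i < j)%N -> (j < M)%N -> X' i = X' j -> H i < H j.
(** The gap makes the planes distinct and forces the descent of another route to cross the final
    ascent of [i] only below [- K i]. For equal abscissas, an earlier route leaves its last corner
    lower. *)
Hypothesis K_X : forall i j, (i < M)%N -> (j < M)%N -> X i < X j -> K j + 2 * R < K i.
Hypothesis K_same : forall i j, (i < j)%N -> (j < M)%N -> X i = X j -> K j + 2 * R < K i.

(* Route [i] leads from the top of the column [(X' i, Y' i)] to the bottom of
   the column [(X i, Y i)]: up to the height [H i], along [dX] to the plane
   [x - z = X i + K i], which no other route uses, inside this plane along [dY],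
   [dW] ([L i] times), [dY] and [dD] down to the height [- K i], then up. *)
Definition on (i : nat) (t : dir) (u : pos) : bool :=
  match t with
  | dU => false
  | dX => [&& pz u =? H i, py u =? Y' i, X' i <=? px u & px u <? H i + X i + K i]
  | dY => [&& pz u =? H i, px u =? H i + X i + K i, Y' i <=? py u & py u <? R + 1]
       || [&& pz u =? H i + L i, px u =? H i + L i + X i + K i, R + 1 <=? py u
            & py u <? Y i + H i + L i + K i]
  | dW => [&& py u =? R + 1, px u - pz u =? X i + K i, H i <=? pz u & pz u <? H i + L i]
  | dD => [&& px u - pz u =? X i + K i, py u - pz u =? Y i + K i, - K i <? pz u
            & pz u <=? H i + L i]
  end.

Definition turn i := Pos (X' i) (Y' i) (H i).

Definition via1 i := Pos (H i + X i + K i) (Y' i) (H i).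
Definition via2 i := Pos (H i + X i + K i) (R + 1) (H i).
Definition via3 i := Pos (H i + L i + X i + K i) (R + 1) (H i + L i).
Definition via4 i := Pos (H i + L i + X i + K i) (Y i + H i + L i + K i) (H i + L i).
Definition via5 i := Pos (X i) (Y i) (- K i).

(* A straight run modifies only its first cell, so these are the cells in which
   the tape differs from the plan once route [i] has been used. *)
Definition corner i u : bool :=
  [|| [&& px u =? X' i, py u =? Y' i & pz u =? H i],
      [&& px u =? H i + X i + K i, py u =? Y' i & pz u =? H i],
      [&& px u =? H i + X i + K i, py u =? R + 1 & pz u =? H i],
      [&& px u =? H i + L i + X i + K i, py u =? R + 1 & pz u =? H i + L i],
      [&& px u =? H i + L i + X i + K i, py u =? Y i + H i + L i + K i & pz u =? H i + L i]
    | [&& px u =? X i, py u =? Y i & pz u =? - K i]].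

Lemma K_sep i j : (i < M)%N -> (j < M)%N -> i <> j ->
  K i + 2 * R < K j \/ K j + 2 * R < K i.
Proof.
move=> iM jM ne; case: (Z.lt_trichotomy (X i) (X j)) => [lt|[e|lt]].
- by right; exact: K_X.
- case: (ltngtP i j) => [lt|lt|e'].
  + by right; apply: K_same.
  + by left; apply: K_same.
  + by rewrite e' in ne.
- by left; exact: K_X.
Qed.

Ltac bounds i iM := have := (bX' iM, bY' iM, bX iM, bY iM, bH iM, bK iM, bL iM);
  move=> -[[[[[[? ?] ?] ?] ?] ?] ?].

Lemma on_uniq i j t t' u : (i < M)%N -> (j < M)%N -> on i t u -> on j t' u ->
  i = j /\ t = t'.
Proof.
move=> iM jM; bounds i iM; bounds j jM.
case: (eqVneq i j) => [<-|/eqP ne].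
  by case: t; case: t' => /= o o'; split=> //; exfalso; lia.
have sep := K_sep iM jM ne; have hne := H_inj iM jM ne.
by case: t; case: t' => /= o o'; exfalso; lia.
Qed.

Lemma corner_on i u : (i < M)%N -> corner i u ->
  (exists t, on i t u) \/ [&& px u =? X i, py u =? Y i & pz u =? - K i].
Proof.
move=> iM; bounds i iM; rewrite /corner.
move=> /or4P[h|h|h|/or3P[h|h|h]]; last by right.
- by left; exists dX; rewrite /=; lia.
- by left; exists dY; rewrite /=; lia.
- by left; case: (Z.eq_dec (L i) 0) => ?; [exists dY|exists dW]; rewrite /=; lia.
- by left; exists dY; rewrite /=; lia.
- by left; exists dD; rewrite /=; lia.
Qed.

Lemma on_corner i j t u : (i < M)%N -> (j < M)%N -> i <> j -> on i t u -> ~~ corner j u.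
Proof.
move=> iM jM ne o; apply/negP => /(corner_on jM)[[t' o']|h].
  by have [] := on_uniq iM jM o o'.
have sep := K_sep iM jM ne; bounds i iM; bounds j jM.
by case: t o => //= o; lia.
Qed.

Lemma up_on i j t u : (i < M)%N -> (j < M)%N -> px u = X' i -> py u = Y' i ->
  R + 1 <= pz u < H i -> on j t u -> (j < i)%N /\ u = turn j.
Proof.
move=> iM jM ex ey hz o; move: o; bounds i iM; bounds j jM.
case: t => //= o; try by exfalso; lia.
have lt := @H_X' j i jM iM; have same := @H_same i j.
have e : X' i = X' j by lia.
split; last by apply: posP => /=; lia.
case: (ltngtP j i) => // [ij|ij]; last by exfalso; subst; lia.
by have := same ij jM e; lia.
Qed.

Lemma up_corner i j u : (i < M)%N -> (j < M)%N -> px u = X' i -> py u = Y' i ->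
  R + 1 <= pz u < H i -> corner j u -> u = turn j.
Proof.
move=> iM jM ex ey hz c; have [[t o]|h] := corner_on jM c.
  by have [] := up_on iM jM ex ey hz o.
by exfalso; bounds j jM; lia.
Qed.

Lemma down_on i j t u : (i < M)%N -> (j < M)%N -> px u = X i -> py u = Y i ->
  - K i <= pz u < - R -> ~~ on j t u.
Proof.
move=> iM jM ex ey hz; apply/negP; bounds i iM; bounds j jM.
case: t => //= o; try by lia.
have lt := @K_X j i jM iM.
case: (eqVneq i j) => [e|/eqP ne]; first by subst; lia.
have := K_sep iM jM ne; lia.
Qed.

Lemma down_corner i j u : (i < M)%N -> (j < i)%N -> px u = X i -> py u = Y i ->
  - K i <= pz u < - R -> ~~ corner j u.
Proof.
move=> iM ji ex ey hz; have jM : (j < M)%N by lia.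
apply/negP => /(corner_on jM) [[t o]|h].
  by have := down_on t iM jM ex ey hz; rewrite o.
by have := K_same ji iM; lia.
Qed.

Lemma box_on i t u : (i < M)%N -> pbox R u -> ~~ on i t u.
Proof.
move=> iM [? ? ?]; apply/negP; bounds i iM.
by case: t => //=; lia.
Qed.

Lemma box_corner i u : (i < M)%N -> pbox R u -> ~~ corner i u.
Proof.
move=> iM bu; apply/negP => /(corner_on iM) [[t o]|h].
  by have := box_on t iM bu; rewrite o.
by case: bu; bounds i iM; lia.
Qed.

Fixpoint plan (m : nat) (u : pos) : dir :=
  if m is m'.+1 then
    if on m' dX u then dX else if on m' dY u then dY else
    if on m' dW u then dW else if on m' dD u then dD else plan m' u
  else dU.

Lemma plan_on m i t u : (m <= M)%N -> (i < m)%N -> on i t u -> plan m u = t.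
Proof.
elim: m => //= m IH mM im o.
have h t' : on m t' u -> t' = t.
  by move=> o'; have [||_ ->] := on_uniq _ _ o o' => //; lia.
case: ifP => [o'|nX]; first exact: (h dX o').
case: ifP => [o'|nY]; first exact: (h dY o').
case: ifP => [o'|nW]; first exact: (h dW o').
case: ifP => [o'|nD]; first exact: (h dD o').
apply: IH => //; first by lia.
case: (eqVneq i m) => [e|]; last by lia.
by move: o; rewrite e; case: (t) => /=; rewrite ?nX ?nY ?nW ?nD.
Qed.

Lemma plan_off m u : (forall i t, (i < m)%N -> ~~ on i t u) -> plan m u = dU.
Proof.
elim: m => //= m IH h.
rewrite ifN; last exact: (h m dX (ltnSn m)).
rewrite ifN; last exact: (h m dY (ltnSn m)).
rewrite ifN; last exact: (h m dW (ltnSn m)).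
rewrite ifN; last exact: (h m dD (ltnSn m)).
by apply: IH => i t im; apply: h; lia.
Qed.

(** Among the used corners the turning cells are controlled, because later routes may rise through
    them. *)
Definition planned (i : nat) (x : tape) :=
  (forall u, (forall j, (j < i)%N -> ~~ corner j u) -> x u = plan M u) /\
  forall j, (j < i)%N -> x (turn j) = dU.

Lemma planned0 : planned 0 (plan M).
Proof. by []. Qed.

Lemma planned_box i x u : (i <= M)%N -> planned i x -> pbox R u -> x u = dU.
Proof.
move=> iM [h _] bu; rewrite h; last by move=> j ji; apply: box_corner bu; lia.
by apply: plan_off => j t jM; exact: box_on bu.
Qed.

Lemma planned_on i x t u : (i < M)%N -> planned i x -> on i t u -> x u = t.
Proof.
move=> iM [h _] o; rewrite h; first exact: plan_on o.
by move=> j ji; apply: (on_corner iM _ _ o); lia.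
Qed.

Lemma planned_up i x z : (i < M)%N -> planned i x -> R + 1 <= z < H i ->
  x (Pos (X' i) (Y' i) z) = dU.
Proof.
move=> iM [h ht] hz; set u := Pos _ _ _.
have [[j [ji e]]|nt] := EM (exists j, (j < i)%N /\ u = turn j).
  by rewrite e ht.
rewrite h.
  apply: plan_off => j t jM; apply/negP => o.
  have [ji e] := @up_on i j t u iM jM erefl erefl hz o.
  by apply: nt; exists j.
move=> j ji; apply/negP => c; apply: nt; exists j; split=> //.
by apply: (@up_corner i j u iM _ erefl erefl hz c); lia.
Qed.

Lemma planned_down i x z : (i < M)%N -> planned i x -> - K i <= z < - R ->
  x (Pos (X i) (Y i) z) = dU.
Proof.
move=> iM [h _] hz; rewrite h; last by move=> j ji; apply: (@down_corner i j (Pos (X i) (Y i) z) iM ji erefl erefl hz).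
by apply: plan_off => j t jM; exact: (@down_on i j t (Pos (X i) (Y i) z) iM jM erefl erefl hz).
Qed.

(** A unit of [H i] costs four steps and a unit of [L i] three. *)
Definition duration i := 4 * H i + 4 * K i + 3 * L i + X i - X' i + Y i - Y' i - 2 * R - 1.

Ltac apart := by left; apply: pos_ne; rewrite /turn /via1 /via2 /via3 /via4 /via5; cbn [px py pz padd pscale vec]; lia.

Lemma route i x : (i < M)%N -> planned i x ->
  exists x', planned i.+1 x' /\
    steps (fun u => ~ pbox R u) (Z.to_nat (duration i))
      (exit (X' i, Y' i) R x) (entry (X i, Y i) R x').
Proof.
move=> iM plx; bounds i iM.
pose Q u := ~ pbox R u.
have Qon t u : on i t u -> Q u by move=> o bu; have := box_on t iM bu; rewrite o.
have r0 : steps Q (Z.to_nat (H i - R - 1)) (exit (X' i, Y' i) R x) (Conf dU (turn i) x).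
  have := @rise Q (Z.to_nat (H i - R - 1)) (X' i) (Y' i) (R + 1) x.
  have -> : R + 1 + Z.of_nat (Z.to_nat (H i - R - 1)) = H i by lia.
  apply=> z hz; split; first by apply: planned_up => //; lia.
  by move=> [_ _ /=]; lia.
have [||s1 [x1 [r1 f1 l1]]] :=
  @segment Q dX dU (turn i) (H i + X i + K i - X' i) x; first by lia.
  move=> k hk; suff o : on i dX (padd (turn i) (pscale k (vec dX))).
    by split; [exact: planned_on o|exact: Qon o].
  by rewrite /on; cbn [px py pz padd pscale vec turn via1 via2 via3 via4 via5]; lia.
have e1 : padd (turn i) (pscale (H i + X i + K i - X' i) (vec dX)) = (via1 i).
  by apply: posP; cbn [px py pz padd pscale vec turn via1 via2 via3 via4 via5]; lia.
rewrite e1 in r1.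
have [||s2 [x2 [r2 f2 l2]]] := @segment Q dY s1 (via1 i) (R + 1 - Y' i) x1; first by lia.
  move=> k hk; suff o : on i dY (padd (via1 i) (pscale k (vec dY))).
    split; last exact: Qon o.
    rewrite f1; last apart.
    exact: planned_on o.
  by rewrite /on; cbn [px py pz padd pscale vec turn via1 via2 via3 via4 via5]; lia.
have e2 : padd (via1 i) (pscale (R + 1 - Y' i) (vec dY)) = (via2 i).
  by apply: posP; cbn [px py pz padd pscale vec turn via1 via2 via3 via4 via5]; lia.
rewrite e2 in r2.
have [||s3 [x3 [r3 f3 l3]]] := @segment Q dW s2 (via2 i) (L i) x2; first by lia.
  move=> k hk; suff o : on i dW (padd (via2 i) (pscale k (vec dW))).
    split; last exact: Qon o.
    rewrite f2; last apart.
    rewrite f1; last apart.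
    exact: planned_on o.
  by rewrite /on; cbn [px py pz padd pscale vec turn via1 via2 via3 via4 via5]; lia.
have e3 : padd (via2 i) (pscale (L i) (vec dW)) = (via3 i).
  by apply: posP; cbn [px py pz padd pscale vec turn via1 via2 via3 via4 via5]; lia.
rewrite e3 in r3.
have [||s4 [x4 [r4 f4 l4]]] :=
  @segment Q dY s3 (via3 i) (Y i + H i + L i + K i - R - 1) x3; first by lia.
  move=> k hk; suff o : on i dY (padd (via3 i) (pscale k (vec dY))).
    split; last exact: Qon o.
    rewrite f3; last first.
      case: (Z.eq_dec (L i) 0) => L0; [by right|left].
      by apply: pos_ne; cbn [px py pz padd pscale vec via2 via3]; lia.
    rewrite f2; last apart.
    rewrite f1; last apart.
    exact: planned_on o.
  by rewrite /on; cbn [px py pz padd pscale vec turn via1 via2 via3 via4 via5]; lia.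
have e4 : padd (via3 i) (pscale (Y i + H i + L i + K i - R - 1) (vec dY)) = (via4 i).
  by apply: posP; cbn [px py pz padd pscale vec turn via1 via2 via3 via4 via5]; lia.
rewrite e4 in r4.
have [||s5 [x5 [r5 f5 l5]]] := @segment Q dD s4 (via4 i) (H i + L i + K i) x4; first by lia.
  move=> k hk; suff o : on i dD (padd (via4 i) (pscale k (vec dD))).
    split; last exact: Qon o.
    rewrite f4; last apart.
    rewrite f3; last apart.
    rewrite f2; last apart.
    rewrite f1; last apart.
    exact: planned_on o.
  by rewrite /on; cbn [px py pz padd pscale vec turn via1 via2 via3 via4 via5]; lia.
have e5 : padd (via4 i) (pscale (H i + L i + K i) (vec dD)) = (via5 i).
  by apply: posP; cbn [px py pz padd pscale vec turn via1 via2 via3 via4 via5]; lia.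
rewrite e5 in r5.
have [||s6 [x6 [r6 f6 l6]]] := @segment Q dU s5 (via5 i) (K i - R) x5; first by lia.
  move=> k hk.
  have e : padd (via5 i) (pscale k (vec dU)) = Pos (X i) (Y i) (- K i + k).
    by apply: posP; cbn [px py pz padd pscale vec turn via1 via2 via3 via4 via5]; lia.
  rewrite e; split; last by move=> [_ _ /=]; lia.
  rewrite f5; last apart.
  rewrite f4; last apart.
  rewrite f3; last apart.
  rewrite f2; last apart.
  rewrite f1; last apart.
  by apply: planned_down => //; lia.
have e6 : padd (via5 i) (pscale (K i - R) (vec dU)) = Pos (X i) (Y i) (- R).
  by apply: posP; cbn [px py pz padd pscale vec turn via1 via2 via3 via4 via5]; lia.
rewrite e6 in r6.
have [|e6' _] := l6; first by lia.
rewrite e6' in r6; exists x6; split; last first.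
  have -> : Z.to_nat (duration i) = (Z.to_nat (H i - R - 1) +
    (Z.to_nat (H i + X i + K i - X' i) + (Z.to_nat (R + 1 - Y' i) + (Z.to_nat (L i) +
    (Z.to_nat (Y i + H i + L i + K i - R - 1) + (Z.to_nat (H i + L i + K i) +
     Z.to_nat (K i - R)))))))%N by rewrite /duration; lia.
  apply: steps_cat r0 _; apply: steps_cat r1 _; apply: steps_cat r2 _.
  apply: steps_cat r3 _; apply: steps_cat r4 _; exact: steps_cat r5 r6.
(* Each run writes only at its first cell, and these cells are corners. *)
have keep u : ~~ corner i u -> x6 u = x u.
  move=> nc; have ne v : corner i v -> u <> v by move=> c e; rewrite e c in nc.
  rewrite f6; last by left; apply: ne; rewrite /corner /=; lia.
  rewrite f5; last by left; apply: ne; rewrite /corner /=; lia.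
  rewrite f4; last by left; apply: ne; rewrite /corner /=; lia.
  rewrite f3; last by left; apply: ne; rewrite /corner /=; lia.
  rewrite f2; last by left; apply: ne; rewrite /corner /=; lia.
  by rewrite f1 //; left; apply: ne; rewrite /corner /=; lia.
have tM j : (j < M)%N -> on j dX (turn j).
  by move=> jM; bounds j jM; rewrite /=; lia.
split=> [u nc|j ji].
  rewrite keep; last exact: nc.
  by case: plx => h _; apply: h => j ji; apply: nc; lia.
(* The run along [dX] drops the carried [dU] at the turning cell. *)
case: (eqVneq j i) => [->|/eqP ne].
  rewrite f6; last apart.
  rewrite f5; last apart.
  rewrite f4; last apart.
  rewrite f3; last apart.
  rewrite f2; last apart.
  by have [|_ ->] := l1; first lia.
have jM : (j < M)%N by lia.
rewrite keep; first by case: plx => _; apply; lia.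
by apply: (on_corner jM iM ne (tM j jM)).
Qed.
End Routes.

(** * Choice of the route parameters *)

Lemma key_lt m a b i j : 0 <= i < m -> 0 <= j < m -> a < b -> a * m + i < b * m + j.
Proof. by move=> ? ? ?; nia. Qed.

Lemma key_bound m a b i : 0 <= a <= b -> 0 <= i <= m -> 0 <= a * m + i <= (b + 1) * m.
Proof. by move=> ? ?; nia. Qed.

Lemma routes (R : Z) (M : nat) (p' p : nat -> Z * Z) : 0 <= R ->
  (forall i, (i < M)%N -> colr R (Pos (p' i).1 (p' i).2 0)) ->
  (forall i, (i < M)%N -> colr R (Pos (p i).1 (p i).2 0)) ->
  exists b : nat, forall d : nat -> nat, (forall i, (i < M)%N -> (b <= d i)%N) ->
  exists planned : nat -> tape -> Prop,
  [/\ exists x, planned 0%N x,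
    forall i x u, (i <= M)%N -> planned i x -> pbox R u -> x u = dU
  & forall i x, (i < M)%N -> planned i x -> exists x', planned i.+1 x' /\
      steps (fun u => ~ pbox R u) (d i) (exit (p' i) R x) (entry (p i) R x')].
Proof.
move=> R0 bp' bp; pose m := Z.of_nat M.
pose X' i := (p' i).1; pose Y' i := (p' i).2; pose X i := (p i).1; pose Y i := (p i).2.
have bX' i : (i < M)%N -> -R <= X' i <= R by move=> /bp' [].
have bY' i : (i < M)%N -> -R <= Y' i <= R by move=> /bp' [].
have bX i : (i < M)%N -> -R <= X i <= R by move=> /bp [].
have bY i : (i < M)%N -> -R <= Y i <= R by move=> /bp [].
(* Lexicographic keys: both grow as the abscissa decreases; for equal abscissas [kH] grows and [kK]
   decreases with the index. *)
pose kH i := (R - X' i) * m + Z.of_nat i.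
pose kK i := (R - X i) * m + (m - Z.of_nat i).
(* The factor [2 * R + 1] turns a difference of keys into a gap larger than [2 * R]. *)
pose K i := 5 * R + 5 + (2 * R + 1) * kK i.
pose base i := 4 * (R + 1 + 3 * kH i) + 4 * K i
  + X i - X' i + Y i - Y' i - 2 * R - 1.
pose B := (2 * R + 1) * m.
have kHB i : (i < M)%N -> 0 <= kH i <= B.
  by move=> iM; apply: key_bound; [have := bX' i iM; lia|rewrite /m; lia].
have kKB i : (i < M)%N -> 0 <= kK i <= B.
  by move=> iM; apply: key_bound; [have := bX i iM; lia|rewrite /m; lia].
pose C := (2 * R + 1) * B.
have KB i : (i < M)%N -> 5 * R + 5 <= K i <= 5 * R + 5 + C.
  by move=> /kKB; rewrite /K /C; nia.
exists (Z.to_nat (4 * (R + 1 + 3 * B) + 4 * (5 * R + 5 + C) + 4 * R + 8)) => d hd.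
(* As 4 is 1 modulo 3, raising the height by [q i] corrects the residue of the duration and [L i]
   supplies the rest. The factor 3 before [kH i] keeps the order of heights under this shift. *)
pose q i := (Z.of_nat (d i) - base i) mod 3.
pose L i := (Z.of_nat (d i) - base i - 4 * q i) / 3.
pose H i := R + 1 + 3 * kH i + q i.
have qB i : 0 <= q i < 3 by apply: Z.mod_pos_bound; lia.
have hL i : 3 * L i = Z.of_nat (d i) - base i - 4 * q i.
  have e := Z.div_mod (Z.of_nat (d i) - base i) 3 ltac:(lia).
  have -> : L i = (Z.of_nat (d i) - base i) / 3 - q i.
    rewrite /L; symmetry; apply: Z.div_unique_exact; first by lia.
    by rewrite /q; lia.
  by rewrite /q; lia.
have baseB i : (i < M)%N -> base i + 8 <= Z.of_nat (d i).
  move=> iM; have := hd i iM; have := kHB i iM; have := KB i iM.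
  by have := (bX' i iM, bY' i iM, bX i iM, bY i iM) => -[[[? ?] ?] ?]; rewrite /base; lia.
have LB i : (i < M)%N -> 0 <= L i.
  by move=> iM; have := baseB i iM; have := hL i; have := qB i; lia.
have kH_lt i j : (i < M)%N -> (j < M)%N -> X' i < X' j -> kH j < kH i.
  by move=> iM jM lt; apply: key_lt; rewrite /m; lia.
have kH_same i j : (i < j)%N -> X' i = X' j -> kH i < kH j.
  by move=> ij e; rewrite /kH e; lia.
have kK_lt i j : (i < M)%N -> (j < M)%N -> X i < X j -> kK j < kK i.
  move=> iM jM lt; suff : (R - X j) * m + (m - 1 - Z.of_nat j) <
    (R - X i) * m + (m - 1 - Z.of_nat i) by rewrite /kK; lia.
  by apply: key_lt; rewrite /m; lia.
have kK_same i j : (i < j)%N -> X i = X j -> kK j < kK i.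
  by move=> ij e; rewrite /kK e; lia.
have KS a b : a < b -> (2 * R + 1) * a + 2 * R < (2 * R + 1) * b by nia.
have bH i : (i < M)%N -> R + 1 <= H i.
  by move=> /kHB; have := qB i; rewrite /H; lia.
have bK i : (i < M)%N -> 5 * R + 5 <= K i by move=> /KB; lia.
have HX i j : (i < M)%N -> (j < M)%N -> X' i < X' j -> H j < H i.
  move=> iM jM lt; have := kH_lt i j iM jM lt; have := qB i; have := qB j.
  by rewrite /H; lia.
have Hs i j : (i < j)%N -> (j < M)%N -> X' i = X' j -> H i < H j.
  move=> ij jM e; have := kH_same i j ij e; have := qB i; have := qB j.
  by rewrite /H; lia.
have Hi i j : (i < M)%N -> (j < M)%N -> i <> j -> H i <> H j.
  move=> iM jM ne; case: (Z.lt_trichotomy (X' i) (X' j)) => [lt|[e|lt]].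
  - by have := HX i j iM jM lt; lia.
  - case: (ltngtP i j) => [lt|lt|//].
    + by have := Hs i j lt jM e; lia.
    + by have := Hs j i lt iM (esym e); lia.
  - by have := HX j i jM iM lt; lia.
have KX i j : (i < M)%N -> (j < M)%N -> X i < X j -> K j + 2 * R < K i.
  by move=> iM jM lt; have := KS _ _ (kK_lt i j iM jM lt); rewrite /K; lia.
have Ks i j : (i < j)%N -> (j < M)%N -> X i = X j -> K j + 2 * R < K i.
  by move=> ij jM e; have := KS _ _ (kK_same i j ij e); rewrite /K; lia.
exists (planned R M X' Y' X Y H K L); split.
- by exists (plan R X' Y' X Y H K L M); exact: planned0.
- by move=> i x u iM; exact: planned_box.
move=> i x iM plx.
have [x' [plx' s]] := route R0 bX' bY' bX bY bH bK LB Hi HX Hs KX Ks iM plx.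
exists x'; split=> //.
suff <- : Z.to_nat (duration R X' Y' X Y H K L i) = d i.
  by move: s; rewrite /X' /Y' /X /Y; case: (p' i); case: (p i).
by rewrite /duration /H; have := hL i; rewrite /base; lia.
Qed.

(** * Timing *)

(* An item with the durations of its crossing before and after its mark. *)
Definition timed := (item * (nat * nat))%type.

Inductive tchain (n R : Z) : tape -> seq timed -> Prop :=
| tchain0 g : tchain n R g [::]
| tchainS g i m1 m2 d g1 l :
    steps (pbox R) m1 (entry (ent i) R g) d ->
    steps (pbox R) m2 d (exit (ext i) R g1) ->
    (forall c, mark i = Some c -> matches n c d) ->
    tchain n R g1 l -> tchain n R g ((i, (m1, m2)) :: l).

Definition item_colr R (i : item) :=
  colr R (Pos (ent i).1 (ent i).2 0) /\ colr R (Pos (ext i).1 (ext i).2 0).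

Lemma chain_timed n P g l g' : chain n P g l g' -> exists R0, forall R, R0 <= R ->
  (forall i, List.In i l -> item_colr R i) /\
  exists tl, map fst tl = l /\ tchain n R g tl.
Proof.
elim=> [{}g|{}g i g1 {}l {}g' [R1 H] _ [R2 IH]].
  by exists 0 => R _; split=> //; exists [::]; split=> //; exact: tchain0.
exists (Z.max (Z.max R1 R2) (Z.abs (ent i).1 + Z.abs (ent i).2 +
  Z.abs (ext i).1 + Z.abs (ext i).2)) => R hR.
have [|ic [tl [etl tc]]] := IH R; first by lia.
split; first by move=> j [<-|/ic //]; rewrite /item_colr /colr /=; lia.
have wb u : inside P R u -> pbox R u by case.
have := H R ltac:(lia); rewrite /crossing; case em: (mark i) => [c|] cr.
  have [_ [m1 [m2 [d [s1 mt s2]]]]] := cr.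
  exists ((i, (m1, m2)) :: tl); rewrite /= etl; split=> //.
  apply: (tchainS (d := d) (g1 := g1)) => //; [exact: steps_mono s1|exact: steps_mono s2|].
  by rewrite em => _ [<-].
have [N s] := cr.
exists ((i, (N, 0%N)) :: tl); rewrite /= etl; split=> //.
apply: (tchainS (d := exit (ext i) R g1) (g1 := g1)) => //.
- exact: steps_mono s.
- exact: steps0.
- by rewrite em.
Qed.

Arguments marks : simpl never.

Section Schedule.
Variables (b : nat) (t : nat -> nat).

Definition has_mark (tl : seq timed) := has (fun x => isSome (mark x.1)) tl.

(* Time until the first mark when every route lasts [b]. *)
Fixpoint delay (tl : seq timed) : nat :=
  if tl is (i, (m1, m2)) :: tl' then
    if mark i is Some _ then m1 else (m1 + m2 + b + delay tl')%N
  else 0%N.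

Fixpoint min_gap (tl : seq timed) : nat :=
  if tl is (i, (m1, m2)) :: tl' then maxn (m2 + b + delay tl') (min_gap tl') else 0%N.

(* Durations of the routes that follow the items; the route that follows the
   mark [j] absorbs the slack in the prescribed gap [t j.+1 - t j]. *)
Fixpoint route_times (j : nat) (tl : seq timed) : seq nat :=
  if tl is (i, (m1, m2)) :: tl' then
    if mark i is Some _ then
      (if has_mark tl' then (t j.+1 - t j - m2 - delay tl')%N else b) :: route_times j.+1 tl'
    else b :: route_times j tl'
  else [::].

Fixpoint mark_times (acc : nat) (tl : seq timed) (rs : seq nat) : seq nat :=
  if tl is (i, (m1, m2)) :: tl' then
    let rest := mark_times (acc + m1 + m2 + head 0%N rs) tl' (behead rs) in
    if mark i is Some _ then (acc + m1)%N :: rest else rest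
  else [::].

Lemma marks_cons i l : marks (i :: l) = if mark i is Some c then c :: marks l else marks l.
Proof. by rewrite /marks /=; case: (mark i). Qed.

Lemma size_marks_has tl : has_mark tl = (0 < size (marks (map fst tl)))%N.
Proof. by elim: tl => //= -[i m] tl IH; rewrite marks_cons /has_mark /=; case: (mark i). Qed.

Definition gaps_ok (g j k : nat) :=
  forall i, (j <= i)%N -> (i.+1 < j + k)%N -> (t i < t i.+1)%N /\ (g <= t i.+1 - t i)%N.

Lemma gaps_mono g j k i : gaps_ok g j k -> (j <= i)%N -> (i < j + k)%N -> (t j <= t i)%N.
Proof.
move=> ok; elim: i => [|i IH] ji ik; first by have -> : j = 0%N by lia.
case: (eqVneq j i.+1) => [->//|/eqP ne]; have [||lt _] := ok i; [lia|lia|].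
by apply: (leq_trans (IH _ _)); lia.
Qed.

(** The route after a mark lasts the prescribed gap minus the rest [m2] of the crossing and the
    [delay] to the next mark; [min_gap] keeps these subtractions from truncating. *)
Lemma mark_timesE tl acc j :
  gaps_ok (min_gap tl) j (size (marks (map fst tl))) ->
  mark_times acc tl (route_times j tl) =
    [seq (acc + delay tl + (t i - t j))%N | i <- iota j (size (marks (map fst tl)))].
Proof.
elim: tl acc j => //= -[i [m1 m2]] tl IH acc j; rewrite marks_cons.
case: (mark i) => [c|] /= ok; last first.
  rewrite IH; first by apply: eq_map => k /=; lia.
  by move=> k jk kj; have := ok k jk kj; lia.
rewrite subnn addn0; congr cons.
rewrite size_marks_has; case: ltnP => [pos|].
  have [||lt gap] := ok j; [by []|by lia|].
  rewrite IH.
    apply/eq_in_map => k; rewrite mem_iota => /andP[jk kj].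
    have le : (t j.+1 <= t k)%N.
      apply: (@gaps_mono 0%N j.+1 _ k _ jk kj).
      by move=> l jl lk; have := ok l ltac:(lia) ltac:(lia); lia.
    by lia.
  by move=> k jk kj; have := ok k ltac:(lia) ltac:(lia); lia.
(* Without further marks the tail contributes no times. *)
rewrite leqn0 => /eqP e.
rewrite e /=.
have : ~~ has_mark tl by rewrite size_marks_has e.
elim: tl {IH ok e} (acc + _ + _ + _)%N j.+1 => //= -[i' [m1' m2']] tl IH acc' j'.
by rewrite /has_mark /=; case: (mark i') => //= /IH.
Qed.

Lemma route_times_ge tl j : gaps_ok (min_gap tl) j (size (marks (map fst tl))) ->
  forall i, (i < size tl)%N -> (b <= nth 0%N (route_times j tl) i)%N.
Proof.
elim: tl j => //= -[i [m1 m2]] tl IH j; rewrite marks_cons.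
case: (mark i) => [c|] /= ok [|k] //=.
- move=> _; rewrite size_marks_has; case: ltnP => //= pos.
  by have [||lt gap] := ok j; [by []|by lia|]; lia.
- by move=> kt; apply: IH => // l jl lk; have := ok l ltac:(lia) ltac:(lia); lia.
- by move=> kt; apply: IH => // l jl lk; have := ok l ltac:(lia) ltac:(lia); lia.
Qed.

End Schedule.

Lemma matches_supl n R c d y : (forall u, pbox R u -> y u = dU) -> n <= R ->
  matches n c d -> matches n c (lift_supl y d).
Proof.
move=> yU nR [e1 e2 e3]; split=> // u nu; rewrite /= /overlay -(e3 u nu).
by case: (tp d u) (yU u (pbox_mono nR nu)).
Qed.

Section Timeline.
Variables (n R : Z) (full : seq timed) (rs : seq nat) (planned : nat -> tape -> Prop).
Variable (i0 : timed).
(** Routes only join consecutive items. *)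
Let M := (size full).-1.
Hypothesis nR : n <= R.
Hypothesis planned_box :
  forall i x u, (i <= M)%N -> planned i x -> pbox R u -> x u = dU.
Hypothesis planned_route : forall i x, (i < M)%N -> planned i x ->
  exists x', planned i.+1 x' /\ steps (fun u => ~ pbox R u) (nth 0%N rs i)
    (exit (ext (nth i0 full i).1) R x) (entry (ent (nth i0 full i.+1).1) R x').

(** Two tapes with disjoint supports evolve in turn: a crossing changes [g], which is [dU] outside
    the box, and a route changes [y], which is [dU] inside it. *)
Lemma timeline c0 i g y acc : (i < size full)%N ->
  tchain n R g (drop i full) -> (forall u, ~ pbox R u -> g u = dU) -> planned i y ->
  iter acc step c0 = entry (ent (nth i0 full i).1) R (overlay g y) ->
  List.Forall2 (fun c t => matches n c (iter t step c0))
    (marks (map fst (drop i full))) (mark_times acc (drop i full) (drop i rs)).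
Proof.
move=> iS; have [k ek] : exists k, k = (size full - i)%N by exists (size full - i)%N.
elim: k i g y acc iS ek => [|k IH] i g y acc iS ek; first by lia.
rewrite (drop_nth i0 iS); case ei: (nth i0 full i) => [it [m1 m2]] tc gU py eacc.
inversion tc as [|? ? ? ? d g1 ? s1 s2 mt tc' e1 e2]; subst.
have yU u : pbox R u -> y u = dU by apply: planned_box py; rewrite /M; lia.
have l1 := steps_supl yU s1; have l2 := steps_supl yU s2.
have i1 := steps_iter l1; have i2 := steps_iter l2.
have im : iter (acc + m1)%N step c0 = lift_supl y d.
  by rewrite addnC iterD eacc -i1.
have im2 : iter (acc + m1 + m2)%N step c0 = exit (ext it) R (overlay g1 y).
  by rewrite addnC iterD im /lift_supl -i2.
have rest : List.Forall2 (fun c t => matches n c (iter t step c0))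
    (marks (map fst (drop i.+1 full)))
    (mark_times (acc + m1 + m2 + head 0%N (drop i rs)) (drop i.+1 full)
       (behead (drop i rs))).
  case: (ltnP i.+1 (size full)) => iS'; last by rewrite drop_oversize.
  have [|y' [py' s3]] := planned_route (i := i) _ py; first by rewrite /M; lia.
  have g1U u : ~ pbox R u -> g1 u = dU.
    by move=> nb; move: (steps_off s2 nb) (steps_off s1 nb) (gU u nb) => /= -> ->.
  have i3 := steps_iter (steps_supr g1U s3).
  rewrite -nth0 nth_drop addn0 -drop1 drop_drop add1n.
  apply: (IH i.+1 g1 y') => //; first by lia.
  by rewrite addnC iterD im2; move: i3; rewrite ei => i3; exact: esym i3.
rewrite /= marks_cons; case em: (mark it) => [c|] //=.
apply: List.Forall2_cons => //; rewrite im; apply: (matches_supl yU nR).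
exact: mt.
Qed.

End Timeline.

Theorem program n cs : 0 <= n -> (0 < size cs)%N ->
  (forall c, List.In c cs -> target n c) ->
  exists n0 : nat, forall t : nat -> nat, t 0%N = 0%N ->
    (forall i, (i.+1 < size cs)%N -> (t i < t i.+1)%N /\ (n0 <= t i.+1 - t i)%N) ->
    exists c0, forall i d, (i < size cs)%N -> matches n (nth d cs i) (iter (t i) step c0).
Proof.
move=> n_ge0 cs0 tcs.
have [r [g [l [g' [ch ml [rg bg] _ _]]]]] := composite n_ge0 tcs 0.
have [R0 H] := chain_timed ch.
pose R := Z.max (Z.max R0 n) (Z.max r rg).
have [|ic [tl [etl tc]]] := H R; first by lia.
have mtl : marks (map fst tl) = cs by rewrite etl.
case: tl etl tc mtl => [|i0 tl'] etl tc mtl; first by move: cs0; rewrite -mtl.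
set tl := i0 :: tl' in etl tc mtl.
have colrs i : (i < size tl)%N -> item_colr R (nth i0 tl i).1.
  move=> iS; apply: ic; rewrite -etl; elim: (tl) i iS => //= x s IH [|i] iS; first by left.
  by right; apply: IH.
have bR u : g u <> dU -> pbox R u by move=> /bg; apply: pbox_mono; lia.
have [|||b hb] := @routes R (size tl).-1 (fun i => ext (nth i0 tl i).1)
  (fun i => ent (nth i0 tl i.+1).1); first by lia.
- by move=> i iM; case: (colrs i) => //; lia.
- by move=> i iM; case: (colrs i.+1) => //; lia.
exists (min_gap b tl) => t t0 ok.
have okt : gaps_ok t (min_gap b tl) 0 (size (marks (map fst tl))).
  by rewrite mtl => i _; exact: ok.
have [|pl [[y py] pbx prt]] := hb (nth 0%N (route_times b t 0 tl)).
  by move=> i iM; apply: (route_times_ge okt); apply: leq_trans iM (leq_pred _).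
pose e := entry (ent i0.1) R (overlay g y).
have tline := @timeline n R tl (route_times b t 0 tl) pl i0 _ pbx prt e 0%N g y 0%N.
(* The clock starts at the first mark. *)
exists (iter (delay b tl) step e) => i d iS; rewrite -iterD.
have {}tline : List.Forall2 (fun c t => matches n c (iter t step e)) cs
    [seq (delay b tl + t j)%N | j <- iota 0 (size cs)].
  have := tline ltac:(lia); rewrite !drop0 mtl.
  have -> : mark_times 0 tl (route_times b t 0 tl) =
      [seq (delay b tl + t j)%N | j <- iota 0 (size cs)].
    by rewrite mark_timesE // mtl; apply: eq_map => j; rewrite t0 subn0.
  apply=> //.
  by move=> u nb; case: (dir_eq_dec (g u) dU) => // /bR.
have sz : size [seq (delay b tl + t j)%N | j <- iota 0 (size cs)] = size cs.
  by rewrite size_map size_iota.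
have ei : (t i + delay b tl)%N = nth 0%N [seq (delay b tl + t j)%N | j <- iota 0 (size cs)] i.
  by rewrite (nth_map 0%N) ?size_iota // nth_iota // add0n addnC.
rewrite ei; elim: tline i iS {ei sz} => //= c s cs' ss h _ IH [|i] iS //.
exact: IH.
Qed.

(** * The Turing machine *)

Local Open Scope classical_set_scope.

Definition dir_code (t : dir) : 'I_5 :=
  match t with
  | dU => inord 0 | dX => inord 1 | dW => inord 2 | dY => inord 3 | dD => inord 4
  end.

Definition dir_decode (i : 'I_5) : dir :=
  match nat_of_ord i with 0%N => dU | 1%N => dX | 2%N => dW | 3%N => dY | _ => dD end.

Lemma dir_codeK : cancel dir_code dir_decode.
Proof. by case; rewrite /dir_decode /= inordK. Qed.

HB.instance Definition _ := Equality.copy dir (can_type dir_codeK).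
HB.instance Definition _ := Choice.copy dir (can_type dir_codeK).
HB.instance Definition _ := Countable.copy dir (can_type dir_codeK).
HB.instance Definition _ := Finite.copy dir (can_type dir_codeK).

Definition pos_of (v : zlattice 3) : pos :=
  Pos (Z_of_int (v ord0 (inord 0))) (Z_of_int (v ord0 (inord 1)))
      (Z_of_int (v ord0 (inord 2))).

Definition row_of (u : pos) : zlattice 3 :=
  (\row_(j < 3) match nat_of_ord j with
    | 0%N => int_of_Z (px u) | 1%N => int_of_Z (py u) | _ => int_of_Z (pz u) end)%R.

Lemma row_ofK u : pos_of (row_of u) = u.
Proof. by apply: posP => /=; rewrite mxE inordK // int_of_ZK. Qed.

Lemma pos_ofK v : row_of (pos_of v) = v.
Proof.
apply/rowP => j; rewrite mxE; case: j => -[|[|[|//]]] h /=; rewrite Z_of_intK;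
  by congr (v _ _); apply: val_inj; rewrite /= inordK.
Qed.

Lemma pos_of_inj v w : pos_of v = pos_of w -> v = w.
Proof. by move=> e; rewrite -(pos_ofK v) e pos_ofK. Qed.

Lemma pos_ofD v w : pos_of (v + w)%R = padd (pos_of v) (pos_of w).
Proof. by apply: posP; rewrite /= mxE raddfD. Qed.

(** Moves must belong to the neighborhood, hence the vectors beside the origin; only the center is
    read and rewritten. *)
Definition nbhd : {fset zlattice 3} :=
  [fset v in (0%R : zlattice 3) :: [seq row_of (vec t) | t <- enum {: dir}]]%fset.

Lemma nbhd0 : (0%R : zlattice 3) \in nbhd.
Proof. by rewrite !inE eqxx. Qed.

Lemma nbhd_vec t : row_of (vec t) \in nbhd.
Proof. by rewrite !inE map_f ?orbT // mem_enum. Qed.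

Definition center : nbhd := [` nbhd0]%fset.

Lemma dir_nonempty : (0 < #|{: dir}|)%N.
Proof. by apply/card_gt0P; exists dU. Qed.

Definition machine : turing_machine 3 :=
  @TuringMachine 3 dir dir_nonempty dir dir_nonempty nbhd
    (fun c => (c.2 center, [ffun m => if m == center then c.1 else c.2 m],
               [` nbhd_vec (c.2 center)]%fset)).

Local Notation space := (moving_head_space machine).

Definition to_space (c : conf) : space :=
  (head_at (st c) (row_of (hd c)) : head_space 3 dir,
   (fun v => tp c (pos_of v)) : tape_space 3 dir).

Lemma moving_head_step c : moving_head (to_space c) = to_space (step c).
Proof.
case: c => s u x; rewrite /to_space /=.
set x' : tape_space 3 dir := fun v => x (pos_of v).
set P : {ffun nbhd -> dir} := restrict nbhd (translate (row_of u) x').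
have Pc : P center = x u.
  by rewrite /P ffunE /translate /x' /= add0r row_ofK.
rewrite (@moving_head_at 3 machine s (row_of u) x' _ _ _ erefl) /= -/P Pc.
congr (_, _).
  by congr head_at; apply: pos_of_inj; rewrite pos_ofD !row_ofK.
apply/funext => v; rewrite /overwrite /upd; case: insubP => [m _ em|nm].
  rewrite ffunE; case: eqP => [e|ne].
    have -> : v = row_of u by apply/eqP; rewrite -subr_eq0 -em e.
    by rewrite row_ofK; case: pos_eq_dec.
  case: pos_eq_dec => e /=; last by rewrite /P ffunE /translate /x' em subrK.
  by case: ne; apply: val_inj; rewrite em -e pos_ofK subrr.
case: pos_eq_dec => //= e.
by move: nm; rewrite -e pos_ofK subrr nbhd0.
Qed.

Lemma moving_head_iter c k : iter k (@moving_head 3 machine) (to_space c) = to_space (iter k step c).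
Proof. by elim: k => //= k ->; rewrite moving_head_step. Qed.

Lemma spaceP (s : space) : (exists x, s = (no_head _ _, x)) \/ exists c, s = to_space c.
Proof.
case: s => h x; case: (head_spaceP h) => [->|[q [v ->]]]; first by left; exists x.
right; exists (Conf q (pos_of v) (fun u => x (row_of u))).
rewrite /to_space /= pos_ofK; congr (_, _).
by apply/funext => w; rewrite pos_ofK.
Qed.

Definition of_space (s : space) : option conf :=
  if locate_head s.1 is Some (q, v) then Some (Conf q (pos_of v) (fun u => s.2 (row_of u)))
  else None.

Lemma to_spaceK c : of_space (to_space c) = Some c.
Proof.
rewrite /of_space locate_head_at /=; case: c => s v x /=; rewrite row_ofK.
by congr (Some (Conf _ _ _)); apply/funext => u; rewrite row_ofK.
Qed.

(** By [step_rev], conjugation with [reverse] inverts the step. *)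
Lemma machine_reversible : reversible machine.
Proof.
pose back (s : space) := if of_space s is Some c then to_space (reverse (step (reverse c))) else s.
exists back => s; case: (spaceP s) => [[x ->]|[c ->]].
- by rewrite moving_head_no_head /back /of_space locate_no_head.
- by rewrite moving_head_step /back to_spaceK step_rev reverseK.
- by rewrite /back /of_space locate_no_head moving_head_no_head.
- rewrite /back to_spaceK moving_head_step; congr to_space.
  by rewrite step_rev reverseK.
Qed.

(** * Topology of the configuration space *)

Local Notation head_sp := (head_space 3 dir).

Lemma ptws_cvg (I : Type) (T : choiceType) (F : set_system {ptws I -> discrete_topology T})
    (f : {ptws I -> discrete_topology T}) : Filter F ->
  (forall i, \forall g \near F, g i = f i) -> F --> f.
Proof.
move=> FF h; apply/cvg_sup => i A [_ [[B Bop <-] Bf] sBA].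
by apply: filterS (h i) => g gi; apply: sBA; rewrite /= /preimage /= gi.
Qed.

Lemma head_cvg (F : set_system head_sp) (h : head_sp) : Filter F ->
  (forall v, \forall g \near F, val g v = val h v) -> F --> h.
Proof.
move=> FF H A [_ [[B Bop <-] Bh] sBA].
have cv : (fun g : head_sp => val g) @ F --> (val h : {ptws zlattice 3 -> discrete_topology (option dir)}).
  by apply: ptws_cvg => v; exact: H.
by apply: (filterS sBA); exact: (cv B (open_nbhs_nbhs (conj Bop Bh))).
Qed.

Definition agree (s : space) (v : zlattice 3) (c : space) :=
  val c.1 v = val s.1 v /\ c.2 v = s.2 v.

Lemma space_cvg (F : set_system space) (s : space) : Filter F ->
  (forall v, \forall c \near F, agree s v c) -> F --> s.
Proof.
move=> FF H A [[B C] [/= nB nC] sBC].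
have c1 : fst @ F --> s.1.
  by apply: head_cvg => v; apply: filterS (H v) => c [].
have c2 : snd @ F --> s.2.
  by apply: ptws_cvg => v; apply: filterS (H v) => c [].
have f1 : F (fst @^-1` B) := c1 B nB.
have f2 : F (snd @^-1` C) := c2 C nC.
by apply: filterS (filterI f1 f2) => c [? ?]; apply: sBC.
Qed.

Lemma ptws_near (T : choiceType) (f : {ptws zlattice 3 -> discrete_topology T}) v :
  \forall g \near f, g v = f v.
Proof.
have := @proj_continuous (zlattice 3) (fun=> discrete_topology T) v f.
by move=> /(_ [set f v] (discrete_set1 _)).
Qed.

Lemma space_near (s : space) v : \forall c \near s, agree s v c.
Proof.
have c1 : (val \o fst : space -> {ptws zlattice 3 -> discrete_topology (option dir)}) @ s
   --> (val s.1 : {ptws zlattice 3 -> discrete_topology (option dir)}).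
  apply: (@cvg_comp _ _ _ fst val _ (nbhs s.1)); first exact: cvg_fst.
  exact: initial_continuous.
have c2 : snd @ s --> s.2 by exact: cvg_snd.
have f1 : \forall c \near s, val c.1 v = val s.1 v.
  exact: (c1 _ (ptws_near (val s.1 : {ptws zlattice 3 -> discrete_topology _}) v)).
have f2 : \forall c \near s, c.2 v = s.2 v by exact: (c2 _ (ptws_near s.2 v)).
by apply: filterS (filterI f1 f2) => c [].
Qed.

Lemma moving_head_tape (c : space) v :
  (moving_head c).2 v = if val c.1 v is Some q then q else c.2 v.
Proof.
case: (spaceP c) => [[x ->]|[{}c ->]]; first by rewrite moving_head_no_head.
rewrite moving_head_step /= /upd; case: pos_eq_dec => e /=.
  by rewrite -e pos_ofK eqxx.
by case: eqP => // ev; rewrite ev row_ofK in e.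
Qed.

(** This local form depends on finitely many coordinates, whence continuity. *)
Lemma moving_head_head (c : space) v :
  val (moving_head c).1 v =
  [pick t | (val c.1 (v - row_of (vec t))%R != None) && (c.2 (v - row_of (vec t))%R == t)].
Proof.
case: (spaceP c) => [[x ->]|[{}c ->]].
  by rewrite moving_head_no_head; case: pickP => //= t; rewrite eqxx.
rewrite moving_head_step; set lhs := val _ v.
have -> : lhs = if v == row_of (hd (step c)) then Some (st (step c)) else None by [].
case: pickP => [t|h] /=.
  case: (eqVneq (v - row_of (vec t))%R (row_of (hd c))) => //= e /eqP et.
  rewrite e row_ofK in et; rewrite et.
  suff -> : v = row_of (padd (hd c) (vec t)) by rewrite eqxx.
  by apply: pos_of_inj; rewrite row_ofK -(subrK (row_of (vec t)) v) e pos_ofD !row_ofK.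
case: eqP => // ev; have /= := h (tp c (hd c)).
have -> : (v - row_of (vec (tp c (hd c))))%R = row_of (hd c).
  apply/eqP; rewrite subr_eq; apply/eqP/pos_of_inj.
  by rewrite ev pos_ofD !row_ofK.
by rewrite eqxx row_ofK eqxx.
Qed.

Lemma moving_head_continuous : continuous (@moving_head 3 machine).
Proof.
move=> s; apply: space_cvg => v.
have H : \forall c \near s, forall t : dir, agree s (v - row_of (vec t))%R c.
  exact: (@filter_forall space dir (fun t => agree s (v - row_of (vec t))%R)
    (nbhs s) (nbhs_filter s) (fun t => space_near s _)).
apply: filterS (filterI H (space_near s v)) => c [Hc [e1 e2]].
split; last by rewrite !moving_head_tape e1 e2.
rewrite !moving_head_head; apply: eq_pick => t /=.
by have [-> ->] := Hc t.
Qed.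

(* The sets that contain every configuration agreeing with [s] on some box form
   a filter that converges to [s]. *)
Lemma open_window (U : set space) (s : space) : open U -> U s ->
  exists n, 0 <= n /\ forall c, (forall v, pbox n (pos_of v) -> agree s v c) -> U c.
Proof.
move=> oU Us.
pose F : set_system space := fun A =>
  exists n, 0 <= n /\ forall c, (forall v, pbox n (pos_of v) -> agree s v c) -> A c.
have FF : Filter F.
  split.
  - by exists 0.
  - move=> A B [n [n0 hA]] [m [m0 hB]]; exists (Z.max n m); split; first by lia.
    move=> c h; split; [apply: hA|apply: hB] => v bv; apply: h; apply: pbox_mono bv; lia.
  - by move=> A B AB [n [n0 hA]]; exists n; split=> // c /hA /AB.
have cv : F --> s.
  apply: space_cvg => v; have [r [r0 hr]] := pbox_pos (pos_of v).
  by exists r; split=> // c; apply.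
exact: cv U (open_nbhs_nbhs (conj oU Us)).
Qed.

Lemma open_target (U : set space) : open U -> U !=set0 ->
  exists nc : Z * conf, [/\ 0 <= nc.1, pbox nc.1 (hd nc.2) &
    forall d, matches nc.1 nc.2 d -> U (to_space d)].
Proof.
move=> oU [s Us]; have [n [n0 hn]] := open_window oU Us.
have [c [Uc hc]] : exists c, U (to_space c) /\ forall v, pbox n (pos_of v) ->
    agree s v (to_space c).
  case: (spaceP s) => [[x es]|[c es]]; last first.
    by exists c; rewrite -es; split=> // v _; split.
  (* A point without head is approximated by placing a head just outside the window. *)
  exists (Conf dU (Pos (n + 1) 0 0) (fun u => x (row_of u))).
  suff h v : pbox n (pos_of v) ->
      agree s v (to_space (Conf dU (Pos (n + 1) 0 0) (fun u => x (row_of u)))).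
    by split; [exact: hn|exact: h].
  rewrite es => bv; split; last by rewrite /= pos_ofK.
  rewrite /=; case: eqP => // ev; move: bv; rewrite ev row_ofK => -[/= ? _ _]; lia.
have [r [r0 hr]] := pbox_pos (hd c).
exists (Z.max n r, c); split=> /=; [by lia|by apply: pbox_mono hr; lia|].
move=> d [e1 e2 e3]; apply: hn => v bv; have [a1 a2] := hc v bv.
split; first by rewrite -a1 /= e1 e2.
by rewrite -a2 /= e3 //; apply: pbox_mono bv; lia.
Qed.

(** * Truncation to finitely many particles and conclusion *)

Definition trunc (n : Z) (x : tape) : tape :=
  fun u => if [&& -n <=? px u, px u <=? n, -n <=? py u, py u <=? n,
                 -n <=? pz u & pz u <=? n] then x u else dU.

Lemma pot_finite_support L (l : seq pos) x :
  (forall u, x u <> dU -> List.In u l) -> exists k, pot L x k.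
Proof.
elim: l x => [|a l IH] x h.
  exists 0%N; suff -> : x = (fun=> dU) by exact: pot0.
  by apply/funext => u; case: (dir_eq_dec (x u) dU) => // /h.
have [u|k pk] := IH (upd x a dU).
  by rewrite /upd; case: pos_eq_dec => //= ne /h [/esym|].
have -> : x = upd (upd x a dU) a (x a) by rewrite upd_upd upd_id.
by exists (k + weight L a (x a))%N; apply: potS => //; rewrite upd_same.
Qed.

Lemma box_finite n : exists l : seq pos, forall u, pbox n u -> List.In u l.
Proof.
pose rng := List.map (fun i => Z.of_nat i - n) (List.seq 0 (Z.to_nat (2 * n + 1))).
have rngP z : -n <= z <= n -> List.In z rng.
  move=> hz; apply/List.in_map_iff; exists (Z.to_nat (z + n)); split; first by lia.
  apply/List.in_seq; lia.
exists (List.flat_map (fun a => List.flat_map (fun b => List.map (Pos a b) rng) rng) rng).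
case=> a b c [/= /rngP ha /rngP hb /rngP hc].
apply/List.in_flat_map; exists a; split=> //; apply/List.in_flat_map; exists b; split=> //.
by apply/List.in_map_iff; exists c.
Qed.

Lemma truncP n x u : pbox n u -> trunc n x u = x u.
Proof. by move=> [? ? ?]; rewrite /trunc ifT //; lia. Qed.

Lemma trunc_supp n x u : trunc n x u <> dU -> pbox n u.
Proof. by rewrite /trunc; case: ifP => // h _; split; lia. Qed.

Lemma box_out n t u : pbox n u -> out n t u.
Proof. by move=> [? ? ?]; case: t => /=; lia. Qed.

(** The radius [n - 1] leaves room for the step back made by [reverse]. *)
Lemma target_trunc n s v x : pbox (n - 1) v -> target n (Conf s v (trunc n x)).
Proof.
move=> bv; have bv' : pbox n v by apply: pbox_mono bv; lia.
have gt : good_tape n (trunc n x).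
  move=> u; case: (dir_eq_dec (trunc n x u) dU) => [->//|/trunc_supp]; exact: box_out.
split.
- by split=> //; [left; exact: box_out|exact: box_out].
- have bh : pbox n (hd (reverse (Conf s v (trunc n x)))).
    by case: bv => ? ? ?; split=> /=; case: s => /=; lia.
  split; [|by left; exact: box_out|exact: box_out].
  move=> u; rewrite /= /ntape.
  case: (dir_eq_dec (trunc n x (popp u)) dU) => [->//|/trunc_supp /pbox_popp]; exact: box_out.
- have [l hl] := box_finite n.
  by apply: (pot_finite_support _ (l := l)) => u /trunc_supp /hl.
Qed.

Lemma matches_trunc n m c d : m <= n ->
  matches n (Conf (st c) (hd c) (trunc n (tp c))) d -> matches m c d.
Proof.
move=> mn [e1 e2 e3]; split=> // u bu.
have bu' : pbox n u by apply: pbox_mono bu.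
by rewrite e3 //= truncP.
Qed.

Theorem theorem5 :
  exists (d : nat) (M : turing_machine d),
    (1 <= d)%N /\ reversible M /\
    mixing_of_all_finite_orders (@moving_head d M).
Proof.
exists 3%N, machine; split=> //; split; first exact: machine_reversible.
split; first exact: moving_head_continuous.
move=> k U k1 oU.
have /choice [nc hnc] : forall i, exists nc : Z * conf, [/\ 0 <= nc.1,
    pbox nc.1 (hd nc.2) & forall d, matches nc.1 nc.2 d -> U i (to_space d)].
  by move=> i; case: (oU i); exact: open_target.
(* One common window; the extra 1 is the margin required by [target_trunc]. *)
pose n := Z.of_nat (\max_i Z.to_nat (nc i).1) + 1.
have ncn i : (nc i).1 <= n - 1.
  have := leq_bigmax (F := fun i => Z.to_nat (nc i).1) i; rewrite /n; lia.
pose tgt i := Conf (st (nc i).2) (hd (nc i).2) (trunc n (tp (nc i).2)).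
pose cs := [seq tgt i | i <- enum 'I_k.+1].
have szcs : size cs = k.+1 by rewrite size_map size_enum_ord.
have [|||n0 hn0] := @program n cs.
- by rewrite /n; lia.
- by rewrite szcs.
- move=> c /List.in_map_iff [i [<- _]]; apply: target_trunc.
  by have [_ b _] := hnc i; apply: pbox_mono b.
exists n0 => t t0 ht.
have [|c0 hc0] := hn0 t t0; first by move=> i; rewrite szcs => ik; apply: ht; lia.
exists (to_space c0) => i _; rewrite /preimage /= moving_head_iter.
have [_ _] := hnc i; apply; apply: (@matches_trunc n); first by have := ncn i; lia.
have := hc0 i (tgt i); rewrite szcs => /(_ (ltn_ord i)).
by rewrite (nth_map i) ?size_enum_ord // nth_ord_enum.
Qed.
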